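(* Let $k\ge2$ and consider the symbolic orbit, short or long, corresponding to a periodic direction $\alpha_{n_1n_2\dots n_k}$ ($0\le n_i\le3$, $n_k\ne0$). Reduce this symbolic orbit, i.e. keep only its sandwiched symbols and delete all other ones, and then replace each symbol $s\in\{1,\dots,5\}$ of the reduced cyclic word by $s+4-n_1$ (taken modulo 5 in $\{1,\dots,5\}$). The resulting cyclic word is the symbolic orbit corresponding to the periodic direction $$\alpha_{3-n_2,\dots,3-n_{k-1},\,4-n_k},$$ short or long, respectively.
   Context: Let $\phi=\frac{1+\sqrt5}{2}$. Let $P$ be a regular plane pentagon of side $1$ with a horizontal side at the bottom; label its sides, counterclockwise starting from the bottom side, by $3,5,2,4,1$. Let $P'=-P$ be its centrally symmetric copy; the side of $P'$ parallel to side $i$ of $P$ is also labelled $i$. The double pentagon $X$ is the flat surface obtained from $P\sqcup P'$ by gluing, for each $i$, the two sides labelled $i$ by a parallel translation. Directions of linear trajectories on $X$ are considered modulo $180^\circ$. The direction making angle $\theta$ (counterclockwise) with the horizontal is identified with the point $x=-\sin 36^\circ\cot\theta\in\mathbb{R}\cup\{\infty\}$. The 3rd sector is $72^\circ\le\theta\le108^\circ$, i.e. $\frac{\phi}{2}-1\le x\le 1-\frac{\phi}{2}$. Regard $\mathbb{R}\cup\{\infty\}$ as the boundary at infinity of the hyperbolic plane. The ideal pentagon of generation $0$ has vertices $1-\frac{\phi}{2},\frac{\phi}{2},\infty,-\frac{\phi}{2},\frac{\phi}{2}-1$ (in cyclic order). The pentagons of generation $k+1$ are obtained from those of generation $k$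 by reflecting each of them in its sides (for $k\ge1$, in its four sides not shared with a pentagon of generation $k-1$). The vertices in the 3rd sector are labelled recursively: put $\alpha=1-\frac{\phi}{2}$ and let $I_\emptyset$ be the arc from $\alpha$ down to $\frac{\phi}{2}-1$. Given an arc $I_{n_1\dots n_k}$ whose endpoints span a side of a pentagon of generation $k$, the pentagon of generation $k+1$ across this side has vertices $v_0>v_1>v_2>v_3>v_4$ with $v_0,v_4$ the endpoints of the arc; set $\alpha_{n_1\dots n_k m}=v_m$ and let $I_{n_1\dots n_k m}$ be the arc from $v_m$ to $v_{m+1}$, $0\le m\le3$ (so $\alpha_{n_1\dots n_k0}=\alpha_{n_1\dots n_k}$, and trailing zeros are dropped). These points are periodic directions: for such a direction $X$ decomposes into two strips of parallel closed trajectories. The symbolic orbit of a closed trajectory is the word in $1,\dots,5$ formed by the labels of the sides consecutively crossed in one traversal, considered up to cyclic permutation; it is the same for all trajectories of one strip. The short (long) symbolic orbit of a periodic direction is that of the strip whose trajectories have the smaller (larger) length. A symbol of a cyclic word is sandwiched if the (cyclically) preceding and following symbols are equal. For example, the reduction of the cyclic word $5\,2\,3\,4\,3\,2\,3\,4\,3\,2$ is $4\,2\,4\,5$. *)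

(* Defs.v *)
From mathcomp Require Import all_boot all_order all_algebra.
From mathcomp Require Import all_classical all_reals all_analysis.

Set Implicit Arguments.
Unset Strict Implicit.
Unset Printing Implicit Defensive.

Import Order.TTheory GRing.Theory Num.Theory.
Local Open Scope ring_scope.

Definition golden (R : realType) : R := (1 + Num.sqrt 5) / 2.

(** The double pentagon.  The sides of P are indexed counterclockwise from the
    bottom one by k : 'I_5; the lower left vertex of P is placed at the origin,
    and the sheet [s : bool] is P for [false] and P' = - P for [true]. *)

Definition side_vec (R : realType) (k : nat) : R * R :=
  (cos (2 * pi * k%:R / 5), sin (2 * pi * k%:R / 5)).

Definition vertex (R : realType) (k : nat) : R * R :=
  \sum_(j < k) side_vec R j.

Definition side_label (k : 'I_5) : nat := nth 0%N [:: 3; 5; 2; 4; 1]%N k.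

(* relatively open: a trajectory may not pass through a vertex *)
Definition on_side (R : realType) (s : bool) (k : 'I_5) (p : R * R) : Prop :=
  exists u : R, 0 < u < 1 /\
    p = (-1) ^+ s *: (vertex R k + u *: side_vec R k).

(* The translation carrying side k of sheet s onto side k of the other sheet:
   on P it sends vertex k to - vertex k.+1 and vertex k.+1 to - vertex k. *)
Definition glue (R : realType) (s : bool) (k : 'I_5) (p : R * R) : R * R :=
  p - (-1) ^+ s *: (vertex R k + vertex R k.+1).

(** A trajectory is recorded by its successive crossings [(s, k, p)]: it leaves
    sheet s through the point p of the side k of that sheet. *)

Definition crossing (R : realType) : Type := (bool * 'I_5 * (R * R))%type.

Definition crossing_side (R : realType) (c : crossing R) : 'I_5 := c.1.2.

Definition exit_point (R : realType) (c : crossing R) : R * R := c.2.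

(* the point at which the next sheet is entered *)
Definition entry_point (R : realType) (c : crossing R) : R * R :=
  glue c.1.1 c.1.2 c.2.

(* From [c], the trajectory of direction d runs through the other pentagon along
   the chord from [entry_point c] to [exit_point c'].  As the pentagon is convex
   and the two ends are on different open sides, the chord is interior to it. *)
Definition next_crossing (R : realType) (d : R * R) (c c' : crossing R) : Prop :=
  [/\ c'.1.1 = ~~ c.1.1,
      crossing_side c' != crossing_side c,
      on_side c'.1.1 (crossing_side c') (exit_point c') &
      exists t : R, 0 < t /\ exit_point c' = entry_point c + t *: d].

(* Both orientations of the direction satisfy this relation, which reflects that
   directions are taken modulo pi.  Only finite x are covered. *)
Definition has_direction (R : realType) (x : R) (d : R * R) : Prop :=
  exists theta : R, [/\ sin theta != 0,
    x = - sin (pi / 5) * (cos theta / sin theta) &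
    d = (cos theta, sin theta)].

(* Repetition-free, so that the cycle is traversed exactly once. *)
Definition closed_trajectory (R : realType) (x : R) (g : seq (crossing R)) :
    Prop :=
  g <> [::] /\ exists d : R * R, has_direction x d /\
    ucycle [rel c c' | `[< next_crossing d c c' >]] g.

Definition euclid_dist (R : realType) (p q : R * R) : R :=
  Num.sqrt ((p.1 - q.1) ^+ 2 + (p.2 - q.2) ^+ 2).

Definition traj_length (R : realType) (g : seq (crossing R)) : R :=
  \sum_(c <- g) euclid_dist (entry_point c) (exit_point (next g c)).

Definition traj_word (R : realType) (g : seq (crossing R)) : seq nat :=
  [seq side_label (crossing_side c) | c <- g].

Variant strip_kind := Short | Long.

(* In a periodic direction the surface is the union of two strips, each filled
   with closed trajectories of one length: those of the short (long) strip are
   the ones of smallest (largest) length. *)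
Definition in_strip (R : realType) (b : strip_kind) (x : R)
    (g : seq (crossing R)) : Prop :=
  closed_trajectory x g /\
  forall g' : seq (crossing R), closed_trajectory x g' ->
    match b with
    | Short => traj_length g <= traj_length g'
    | Long => traj_length g' <= traj_length g
    end.

(* [w] represents the cyclic word common to all trajectories of the strip *)
Definition symbolic_orbit (R : realType) (b : strip_kind) (x : R)
    (w : seq nat) : Prop :=
  (exists2 g, in_strip b x g & traj_word g = w) /\
  (forall g, in_strip b x g -> exists i : nat, traj_word g = rot i w).

(** Ideal pentagons; a point of the boundary at infinity of the upper half-plane
    is an [option R], with [None] for the point at infinity. *)

(* The reflection in the geodesic with endpoints a and b acts on the boundary as
   the inversion in the circle with diameter [a, b]. *)
Definition reflect_geodesic (R : realType) (a b : R) (z : option R) : option R :=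
  let c := (a + b) / 2 in
  let r := (a - b) / 2 in
  match z with
  | None => Some c
  | Some y => if y == c then None else Some (c + r ^+ 2 / (y - c))
  end.

(* An arc from [arc_top] down to [arc_bot], whose endpoints span a side of the
   ideal pentagon with vertices [arc_pentagon]. *)
Record arc (R : realType) := Arc {
  arc_pentagon : seq (option R);
  arc_top : R;
  arc_bot : R }.

(* The vertices v_0 > v_1 > ... of the reflected pentagon across the arc; [pmap]
   drops the option type, all five vertices being finite for the arcs below. *)
Definition vertices_across (R : realType) (I : arc R) : seq R :=
  sort (fun y z : R => z <= y)
    (pmap (reflect_geodesic (arc_top I) (arc_bot I)) (arc_pentagon I)).

Definition sub_arc (R : realType) (I : arc R) (m : nat) : arc R :=
  let v := vertices_across I in
  Arc [seq Some y | y <- v] (nth 0 v m) (nth 0 v m.+1).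

Definition arc0 (R : realType) : arc R :=
  let h := golden R / 2 in
  Arc [:: Some (1 - h); Some h; None; Some (- h); Some (h - 1)] (1 - h) (h - 1).

(* the arc I_{n_1 ... n_k} *)
Definition arc_of (R : realType) (ns : seq nat) : arc R :=
  foldl (@sub_arc R) (arc0 R) ns.

(* alpha_{n_1 ... n_k} is the endpoint from which I_{n_1 ... n_k} descends *)
Definition alpha (R : realType) (ns : seq nat) : R := arc_top (arc_of R ns).

(** Operations on cyclic words, given by any of their linear representatives *)

(* keeps the symbols whose cyclic predecessor and successor coincide *)
Definition reduction (w : seq nat) : seq nat :=
  mask [seq ab.1 == ab.2 | ab <- zip (rotr 1 w) (rot 1 w)] w.

Example reduction_example :
  reduction [:: 5; 2; 3; 4; 3; 2; 3; 4; 3; 2]%N = rot 3 [:: 4; 2; 4; 5]%N.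
Proof. by []. Qed.

(* s + m modulo 5, with representatives 1, ..., 5 *)
Definition shift_symbol (m s : nat) : nat := ((s + m).-1 %% 5).+1.

(* Main.v *)
Require Import Defs.
From mathcomp Require Import all_boot all_order all_algebra.
From mathcomp Require Import all_classical all_reals all_analysis.
From mathcomp Require Import ring lra.

(** The central symmetry of X preserves the labels, so a trajectory can be
    followed on P alone: run along a chord of P in the given direction, flip the
    side that is reached about its midpoint, and go on.  For a direction of the
    third sector the chords join the bottom sides 1, 3, 5 to the top sides 4, 2.
    Projecting P along the direction turns the sides into intervals, a trajectory
    into an orbit of a point under flips of these intervals, and two consecutive
    labels are always neighbours in the list 1, 4, 3, 2, 5.  A symbolic orbit is
    thus a closed walk on a path with five vertices, and its sandwiched symbols
    are the turning points of the walk.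

    Restricted to its turning points, the system of flips is again such a system.
    Geometrically, the sandwiched crossings of a side are the crossings of its
    image under the orientation-reversing affine automorphism of X that preserves
    the directions 72 and 108 degrees; it sends the direction out of the third
    sector, and the clockwise rotation by 36 (n1 + 1) degrees brings it back,
    whence the shift of the labels.  Here all this is carried out on the projections.  The
    overlaps of neighbouring intervals have lengths A, f B, f A, B with f the
    golden ratio, and those of the new system are A', f B', f A', B' for a linear
    function (A', B') of (A, B) that depends on n1 only ([new_golden_gaps]).
    Between two turns a coordinate is constant, and at a turn it is flipped
    ([step_straight], [step_turning]); conversely each step of the new system is
    a straight run of the old one ([step_unrenorm]).  So the closed trajectories
    of both directions correspond to each other, and their words correspond by
    reduction and relabelling ([ucycle_contract], [ucycle_expand]).

    Short and long orbits are respected because all lengths are multiplied by one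
    factor: the length of a closed trajectory is a linear function of the numbers
    of its labels ([traj_length_cross]), and passing to the turning points
    multiplies this function by a constant ([total_weight_contract]).

    It remains to identify the new direction.  On the abscissa x the passage from
    (A, B) to (A', B') is a decreasing Moebius map, which sends the pentagon
    beyond the arc I_n1 to the pentagon beyond the whole sector.  Moebius maps
    commute with the reflections, so the same holds for all later generations;
    since the map is decreasing, the vertex v_m goes to v_(4 - m) and the arc
    with last index n to the arc with last index 3 - n ([mirrored_sub_arc],
    [alpha_moebius]). *)

Set Implicit Arguments.
Unset Strict Implicit.
Unset Printing Implicit Defensive.

Import Order.TTheory GRing.Theory Num.Theory.

(** * Cyclic words and cycles of a relation *)

Section Cyc.
Variable T : eqType.
Implicit Types (s p : seq T) (x y : T) (r : rel T).

Lemma rot1_next s : uniq s -> rot 1 s = [seq next s x | x <- s].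
Proof.
case: s => [//|x p] Up; apply: (@eq_from_nth _ x); first by rewrite size_rot size_map.
move=> i; rewrite size_rot => lti; rewrite (nth_map x) // next_nth mem_nth //.
rewrite index_uniq // rot1_cons nth_rcons.
case: (ltngtP i (size p)) lti => [hi _|hi|-> _]; first by [].
  by rewrite /= ltnS leqNgt hi.
by rewrite nth_default.
Qed.

Lemma rotr1_prev s : uniq s -> rotr 1 s = [seq prev s x | x <- s].
Proof.
move=> Us; transitivity (rotr 1 [seq prev s x | x <- rot 1 s]).
  by rewrite rot1_next // -map_comp map_id_in // => x _ /=; rewrite prev_next.
by rewrite map_rot rotK.
Qed.

Lemma map_next_perm s : uniq s -> perm_eq [seq next s x | x <- s] s.
Proof. by move=> Us; rewrite -rot1_next // perm_rot. Qed.

Lemma map_prev_perm s : uniq s -> perm_eq [seq prev s x | x <- s] s.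
Proof. by move=> Us; rewrite -rotr1_prev // perm_rotr. Qed.

Lemma reduction_map (lab : T -> nat) (P : pred T) s : uniq s ->
  {in s, forall x, (lab (prev s x) == lab (next s x)) = P x} ->
  reduction (map lab s) = map lab (seq.filter P s).
Proof.
move=> Us sP; rewrite /reduction -map_rotr -map_rot rotr1_prev // rot1_next //.
rewrite -!map_comp zip_map -map_comp filter_mask map_mask; congr mask.
by apply/eq_in_map => x xs; rewrite /= -sP.
Qed.

Lemma zip_rot (S U : Type) i (s : seq S) (t : seq U) :
  size s = size t -> zip (rot i s) (rot i t) = rot i (zip s t).
Proof.
move=> st; rewrite /rot zip_cat ?size_drop ?st //; congr (_ ++ _).
  by elim: s t i st => [|x s IH] [|y t] [|i] //= [/IH].
by elim: s t i st => [|x s IH] [|y t] [|i] //= [/IH->].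
Qed.

Lemma reduction_rot i (w : seq nat) :
  exists j, reduction (rot i w) = rot j (reduction w).
Proof.
rewrite /reduction rot_rot -rot_rotr zip_rot ?size_rot ?size_rotr //.
rewrite map_rot mask_rot ?size_map ?size_zip ?size_rot ?size_rotr ?minnn //.
by eexists.
Qed.

(** [Inv x y] is what is remembered on the way from the last state [x] in [P] to
    the present state [y]: a step out of [P] establishes it, a step from outside
    [P] keeps it, and on the return to [P] it yields a step of the new relation. *)
Lemma path_contract r r' (P : pred T) (Inv : T -> T -> Prop) :
  (forall x y, P x -> r x y -> Inv x y) ->
  (forall x y z, Inv x y -> ~~ P y -> r y z -> Inv x z) ->
  (forall x y, P x -> P y -> Inv x y -> r' x y) ->
  forall s x, P x -> path r x s -> P (last x s) -> path r' x (seq.filter P s).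
Proof.
move=> H1 H2 H3.
suff H: forall s x y, P x -> Inv x y -> path r y s -> P (last y s) ->
    path r' x (seq.filter P (y :: s)).
  case=> [//|y s] x Px /= /andP[rxy ps] Pl; exact: H (H1 _ _ _ _) ps Pl.
elim=> [|z s IH] x y Px Ixy /=; first by move=> _ Py; rewrite Py /= H3.
case/andP=> ryz ps Pl; case: ifP => Py.
  by rewrite /= H3 //=; apply: IH (H1 _ _ _ _) ps Pl.
by apply: (IH x z) => //; apply: H2 Ixy _ ryz; rewrite Py.
Qed.

Lemma cycle_contract r r' (P : pred T) (Inv : T -> T -> Prop) :
  (forall x y, P x -> r x y -> Inv x y) ->
  (forall x y z, Inv x y -> ~~ P y -> r y z -> Inv x z) ->
  (forall x y, P x -> P y -> Inv x y -> r' x y) ->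
  forall s, cycle r s -> cycle r' (seq.filter P s).
Proof.
move=> H1 H2 H3 s cs; case: (boolP (has P s)) => [/hasP[x xs Px]|]; last first.
  by rewrite has_filter negbK => /eqP->.
case: (rot_to xs) => i p Ep.
have: cycle r' (seq.filter P (rot i s)).
  have: cycle r (rot i s) by rewrite rot_cycle.
  rewrite Ep /= Px /= => cp.
  have := path_contract H1 H2 H3 Px cp; rewrite last_rcons Px filter_rcons Px.
  by apply.
have [j ->] : exists j, seq.filter P (rot i s) = rot j (seq.filter P s);
  last by rewrite rot_cycle.
by rewrite !filter_mask map_rot mask_rot ?size_map //; eexists.
Qed.

Definition deterministic r := forall x y z, r x y -> r x z -> y = z.

Lemma path_deterministic_return r x y p1 p2 : deterministic r ->
  path r y (rcons p1 x) -> path r y (rcons p2 x) ->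
  x \notin p1 -> x \notin p2 -> p1 = p2.
Proof.
move=> fr; elim: p1 p2 y => [|z p1 IH] [|t p2] y //=.
- by rewrite andbT inE => ryx /andP[/(fr _ _ _ ryx)<-]; rewrite eqxx.
- by move=> /andP[ryz _] /andP[/(fr _ _ _ ryz)<-]; rewrite inE eqxx.
move=> /andP[ryz pz] /andP[/(fr _ _ _ ryz)<- pt].
by rewrite !inE !negb_or => /andP[_ x1] /andP[_ x2]; rewrite (IH p2 z).
Qed.

(** From a common element on, both cycles have no choice until they return to it. *)
Lemma ucycle_deterministic_rot r s1 s2 x : deterministic r ->
  ucycle r s1 -> ucycle r s2 -> x \in s1 -> x \in s2 -> exists i, s2 = rot i s1.
Proof.
move=> fr /andP[c1 u1] /andP[c2 u2] x1 x2.
case: (rot_to x1) => i p1 E1; case: (rot_to x2) => j p2 E2.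
suff E : p1 = p2.
  have -> : s2 = rotr j (rot i s1) by rewrite E1 E -E2 rotK.
  by rewrite /rotr rot_rot_add; eexists.
move: c1 u1 c2 u2; rewrite -(rot_cycle i _ s1) -(rot_uniq i s1) E1.
rewrite -(rot_cycle j _ s2) -(rot_uniq j s2) E2 /=.
move=> c1 /andP[x1' _] c2 /andP[x2' _]; exact: (path_deterministic_return fr c1 c2).
Qed.

(** Loop removal may cut pieces off the return path, but keeps its starting point. *)
Lemma ucycle_of_return r x p : path r x (rcons p x) ->
  exists2 s, ucycle r s & x \in s.
Proof.
rewrite rcons_path => /andP[pp]; case/shortenP: pp => p' pp' up' _ rx'.
exists (x :: p'); last exact: mem_head.
by apply/andP; split; rewrite //= rcons_path pp'.
Qed.
End Cyc.

Local Open Scope ring_scope.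

(** * Intervals with flips *)

Section Flip.
Variable R : realFieldType.

(** The sides labelled 1, 4, 3, 2, 5 get the positions 0, 1, 2, 3, 4: the even ones
    form the bottom of P, the odd ones its top.  Projected along the direction,
    the side at position p covers the interval from [cut g p.-1] to [cut g p.+1],
    where the values of [cut] at 4 and 5 agree.  So the gap numbered p is the
    overlap of the sides at positions p and p.+1, that is the width of the band of
    chords which join them. *)
Record gaps := Gaps { gap0 : R; gap1 : R; gap2 : R; gap3 : R }.

Definition gaps_pos (g : gaps) : bool :=
  [&& 0 < gap0 g, 0 < gap1 g, 0 < gap2 g & 0 < gap3 g].

Definition cut (g : gaps) (n : nat) : R :=
  match n with
  | 0 => 0
  | 1 => gap0 g
  | 2 => gap0 g + gap1 g
  | 3 => gap0 g + gap1 g + gap2 g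
  | _ => gap0 g + gap1 g + gap2 g + gap3 g
  end.

Definition lower (g : gaps) (p : nat) := cut g p.-1.
Definition upper (g : gaps) (p : nat) := cut g p.+1.
Definition flip (g : gaps) (p : nat) (y : R) : R := lower g p + upper g p - y.

Definition state : Type := (nat * R)%type.

Definition inside (g : gaps) (x : state) : bool :=
  (x.1 <= 4)%N && (lower g x.1 < x.2 < upper g x.1).

(** A state is the position of a crossed side and the projection of the point at
    which it is reached.  The flip of this point starts a chord, which ends on the
    other one of the two chains at a point with the same projection. *)
Definition step (g : gaps) (x x' : state) : bool :=
  [&& inside g x, inside g x', odd x'.1 != odd x.1 & x'.2 == flip g x.1 x.2].

(** A state that is reached by a step comes from position p.-1 if and only if it
    lies below [cut g p]; so the sense in which the walk arrives can be read off
    the state. *)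
Definition rightward (g : gaps) (x : state) : bool := x.2 < cut g x.1.

Definition turning (g : gaps) (x : state) : bool :=
  let c := cut g x.1 in let y' := flip g x.1 x.2 in
  [&& x.2 < c & y' < c] || [&& c < x.2 & c < y'].

Ltac flip_unfold := rewrite /inside /rightward /turning /flip /lower /upper /=.

(** Intervals at positions of different parity are disjoint unless the positions
    are consecutive, and then they overlap between the corresponding two cuts. *)
Lemma stepP (g : gaps) (x x' : state) : gaps_pos g -> step g x x' ->
  [/\ inside g x, inside g x', x'.2 = flip g x.1 x.2 &
   (x.1 = x'.1.+1 /\ cut g x'.1 < x'.2 < cut g x.1) \/
   (x'.1 = x.1.+1 /\ cut g x.1 < x'.2 < cut g x'.1)].
Proof.
case: g x x' => g0 g1 g2 g3 [p y] [p' y'].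
rewrite /gaps_pos /step => /and4P[/= h0 h1 h2 h3] /and4P[xi xi' /= po /eqP Ey].
split=> //; move: xi xi' po Ey; flip_unfold.
case: p => [|[|[|[|[|p]]]]] //=; case: p' => [|[|[|[|[|p']]]]] //= H H' _ Ey.
all: first [by exfalso; lra | by left; split; [by [] | lra] | by right; split; [by [] | lra]].
Qed.

Lemma step_deterministic g : gaps_pos g -> deterministic (step g).
Proof.
move=> gp [p y] [p1 y1] [p2 y2] /(stepP gp)[/= _ _ -> H1] /(stepP gp)[/= _ _ -> H2].
by case: H1 H2 => [[E1 /andP[h1 h2]]|[E1 /andP[h1 h2]]] [[E2 /andP[h3 h4]]|[E2 /andP[h3 h4]]];
  [rewrite E1 in E2; case: E2 => ->
  | have := lt_trans h2 h3; rewrite ltxx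
  | have := lt_trans h1 h4; rewrite ltxx
  | rewrite E1 E2].
Qed.

Lemma step_neq_cut g x x' : gaps_pos g -> step g x x' -> x'.2 != cut g x'.1.
Proof.
move=> gp /(stepP gp)[_ _ E1].
by case=> [[_ /andP[h1 h2]]|[_ /andP[h1 h2]]]; [rewrite gt_eqF | rewrite lt_eqF].
Qed.

(** The state determines the previous position, and its flip the next one. *)
Lemma turning_step g x0 x x1 : gaps_pos g -> step g x0 x -> step g x x1 ->
  (x0.1 == x1.1) = turning g x.
Proof.
move=> gp /(stepP gp)[_ _ _ H0] /(stepP gp)[_ _ E1]; rewrite /turning -E1.
case: H0 => [[Ex0 /andP[k1 _]]|[Ex0 /andP[_ k1]]];
  case=> [[Ex /andP[_ k2]]|[Ex /andP[k2 _]]]; rewrite k1 k2 (lt_gtF k1) (lt_gtF k2) /=.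
- by rewrite Ex0 Ex gtn_eqF ?ltnS ?leqnSn.
- by rewrite Ex0 Ex eqxx.
- by move: Ex0; rewrite Ex => -[->]; rewrite eqxx.
- by rewrite Ex Ex0 ltn_eqF ?ltnS ?leqnSn.
Qed.

(** * Turning points *)

(** At position p the turning points fill the interval that has [cut g p] as an
    endpoint and the same midpoint as the side.  For a direction in the n-th
    sub-arc, these five intervals, carried over to the order of [renumbering n],
    form a new system of the same kind, with these overlaps. *)
Definition new_gaps (n : nat) (g : gaps) : gaps :=
  let: Gaps g0 g1 g2 g3 := g in
  match n with
  | 0 => Gaps (g3 - g2) g2 (g1 - g2 - g0) g0
  | 1 => Gaps (g1 - g2) (g0 - g1 + g2) (g3 - g0 + g1 - g2) (g2 - g3)
  | 2 => Gaps (g1 - g0) (g0 - g3 + g2 - g1) (g3 - g2 + g1) (g2 - g1)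
  | _ => Gaps g3 (g2 - g1 - g3) g1 (g0 - g1)
  end.

(** The entry with index p is the new position of the side at position p.  On the
    labels this is the shift by 4 - n, which is the effect on the labels of the
    clockwise rotation by 36 (n + 1) degrees; see [shift_pos_label]. *)
Definition renumbering (n : nat) : seq nat :=
  nth [::] [:: [:: 4; 2; 3; 0; 1]; [:: 1; 3; 0; 4; 2];
               [:: 2; 0; 4; 1; 3]; [:: 3; 4; 1; 2; 0]]%N n.

Definition new_pos (n p : nat) : nat := nth 0%N (renumbering n) p.

Definition old_pos (n p : nat) : nat := index p (renumbering n).

(** Within one sub-arc, the turns at a given position are either all maxima or all
    minima of the walk; this table tells at which positions they are maxima. *)
Definition turns_rightward (n p : nat) : bool :=
  nth false (nth [::] [:: [:: false; false; true; false; true];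
     [:: false; false; true; true; true]; [:: false; false; false; true; true];
     [:: false; true; false; true; true]] n) p.

Definition middle (g : gaps) (p : nat) : R := (lower g p + upper g p) / 2.

(** Passing straight through a side reverses its projection.  The sign alternates
    with the position, so that [new_coord] does not notice this, and it changes
    with the sense of arrival, which only the turns reverse. *)
Definition new_sign (n p : nat) (b : bool) : R := if odd n (+) odd p (+) b then 1 else -1.

Definition new_coord n g (x : state) : R :=
  middle (new_gaps n g) (new_pos n x.1) +
  new_sign n x.1 (rightward g x) * (x.2 - middle g x.1).

Definition renorm n g (x : state) : state := (new_pos n x.1, new_coord n g x).

Definition unrenorm n g (x : state) : state :=
  let p := old_pos n x.1 in
  (p, middle g p + new_sign n p (turns_rightward n p) * (x.2 - middle (new_gaps n g) x.1)).

Section Renorm.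
Variables (n : nat) (g : gaps).
Hypotheses (n3 : (n <= 3)%N) (gp : gaps_pos g) (gp' : gaps_pos (new_gaps n g)).
Let g' := new_gaps n g.

Ltac flip_cases x :=
  case: g x gp gp' => g0 g1 g2 g3;
  case: n n3 => [|[|[|[|]]]] // _ [[|[|[|[|[|p]]]]] u]
    /and4P[/= h0 h1 h2 h3] /and4P[/= k0 k1 k2 k3];
  rewrite /middle /new_sign; flip_unfold; rewrite //=.

Lemma turning_rightward x : inside g x -> turning g x ->
  rightward g x = turns_rightward n x.1.
Proof.
flip_cases x => H; case: (ltgtP u _) => // hu; case: ltgtP => // hf; lra.
Qed.

Lemma renorm_inside x : inside g x -> turning g x -> inside g' (renorm n g x).
Proof.
rewrite /renorm /new_coord /g'; flip_cases x => H.
all: case: (ltgtP u _) => // hu; case: ltgtP => // hf _ /=; lra.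
Qed.

(** A run between two turns is one chord of the new system, and [new_coord] is the
    projection of this chord: it stays the same along the run. *)
Lemma step_straight x y : step g x y -> x.2 != cut g x.1 -> ~~ turning g x ->
  rightward g y = rightward g x /\ new_coord n g y = new_coord n g x.
Proof.
move=> /(stepP gp)[xi _]; rewrite /new_coord; case: y => q v /= ->; move: xi.
flip_cases x => H.
all: case: (ltgtP u _) => // hu [] [E H1] // _; move: H1; try case: E => E;
  subst q => //= /andP[ha hb].
all: rewrite ?ha ?hb ?(lt_gtF ha) ?(lt_gtF hb) // => _; split=> //=; lra.
Qed.

(** The sense of arrival changes together with the parity of the position, so the
    sign in [new_coord] stays, and the flip about the old midpoint shows up as the
    flip about the new one. *)
Lemma step_turning x y : step g x y -> turning g x ->
  rightward g y = ~~ rightward g x /\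
  new_coord n g y = flip g' (new_pos n x.1) (new_coord n g x).
Proof.
move=> /(stepP gp)[xi _]; rewrite /new_coord /g'; case: y => q v /= ->; move: xi.
flip_cases x => H.
all: case: (ltgtP u _) => // hu [] [E H1] // T; move: H1 T; try case: E => E;
  subst q => //= /andP[ha hb].
all: rewrite ?ha ?hb ?(lt_gtF ha) ?(lt_gtF hb) // => _; split=> //=; lra.
Qed.

(** Maxima and minima of the walk become the two chains of the new system. *)
Lemma odd_new_pos p : (p <= 4)%N -> odd (new_pos n p) = turns_rightward n p (+) odd n.
Proof. by case: n n3 p => [|[|[|[|]]]] // _ [|[|[|[|[|]]]]]. Qed.

Lemma step_renorm x y : inside g x -> inside g y -> turning g x -> turning g y ->
  rightward g y = ~~ rightward g x ->
  new_coord n g y = flip g' (new_pos n x.1) (new_coord n g x) ->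
  step g' (renorm n g x) (renorm n g y).
Proof.
move=> xi yi xt yt; rewrite !turning_rightward // => exy Ey.
rewrite /step !renorm_inside //= Ey eqxx andbT.
move/andP: xi => [px _]; move/andP: yi => [py _].
by rewrite !odd_new_pos // exy; case: turns_rightward; case: odd.
Qed.

Lemma unrenorm_inside x : inside g' x -> inside g (unrenorm n g x).
Proof. rewrite /unrenorm /g'; flip_cases x => H; lra. Qed.

Lemma unrenorm_turning x : inside g' x -> turning g (unrenorm n g x).
Proof. rewrite /unrenorm /g'; flip_cases x => H; lra. Qed.

Lemma unrenormK x : inside g' x -> renorm n g (unrenorm n g x) = x.
Proof.
move=> xi; rewrite /renorm /new_coord turning_rightward ?unrenorm_inside ?unrenorm_turning //.
move: xi; rewrite /unrenorm /g'; flip_cases x => H; congr pair; lra.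
Qed.

Definition glide (b : bool) (x : state) : state :=
  (if b then x.1.+1 else x.1.-1, flip g x.1 x.2).

(** The old path goes straight from one turning point to the other.  It does not
    leave the intervals that it traverses, because the band of chords of a new step
    lies in each of the overlaps that are passed. *)
Lemma step_unrenorm X Y : step g' X Y ->
  exists q, path (step g) (unrenorm n g X) (rcons q (unrenorm n g Y)).
Proof.
move=> /(stepP gp')[Xi + +]; case: Y => Q v /andP[/= Q4 _] ->.
(* m is the number of sides between the two turning points, the last included *)
suff H: forall m,
   m = (old_pos n Q - old_pos n X.1 + (old_pos n X.1 - old_pos n Q))%N -> (Q <= 4)%N ->
   (X.1 = Q.+1 /\ cut g' Q < flip g' X.1 X.2 < cut g' X.1 \/
    Q = X.1.+1 /\ cut g' X.1 < flip g' X.1 X.2 < cut g' Q) ->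
   (0 < m)%N /\ let f := glide (~~ turns_rightward n (old_pos n X.1)) in
     let x := unrenorm n g X in
     path (step g) x (traject f (f x) m) /\
     last x (traject f (f x) m) = unrenorm n g (Q, flip g' X.1 X.2).
  move/(H _ erefl Q4) => {H} [m0] /=; set t := traject _ _ _.
  have: (0 < size t)%N by rewrite size_traject.
  case/lastP: t => // q z _ [pq]; rewrite last_rcons => <-; by exists q.
move=> m; move: Xi; rewrite /unrenorm /g' /step /glide; flip_cases X => H;
  rewrite /old_pos /renumbering => Em Q4' [] [E H1] //; move: H1 Em Q4'; clear Q4;
    try case: E => E; subst Q => //= /andP[ha hb] Em // _; subst m;
      rewrite /old_pos /renumbering //=.
all: split=> //=; rewrite ?eqxx ?andbT; split; [lra | congr pair; lra].
Qed.

Lemma renormK x : inside g x -> turning g x -> unrenorm n g (renorm n g x) = x.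
Proof.
move=> xi xt; have := turning_rightward xi xt; move: xi xt.
rewrite /renorm /new_coord /unrenorm /old_pos /renumbering; flip_cases x => H _ -> /=.
all: congr pair; lra.
Qed.

Definition turn_states (s : seq state) : seq state :=
  [seq renorm n g x | x <- s & turning g x].

(** The invariant kept since the last turn is the constancy of [new_coord] and of
    the sense of the walk; at the next turn they are what [step_renorm] asks for. *)
Lemma ucycle_contract s : ucycle (step g) s -> ucycle (step g') (turn_states s).
Proof.
case/andP=> cs us.
have si : {in s, forall x, inside g x}.
  by move=> x xs; have /and4P[] := next_cycle cs xs.
apply/andP; split; last first.
  rewrite map_inj_in_uniq ?filter_uniq // => x y.
  rewrite !mem_filter => /andP[xt xs] /andP[yt ys] Exy.
  by rewrite -(renormK (si x xs) xt) Exy renormK ?si.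
rewrite /turn_states cycle_map.
pose Inv x y := [/\ inside g x, (exists w, step g w y),
  rightward g y = ~~ rightward g x &
  new_coord n g y = flip g' (new_pos n x.1) (new_coord n g x)].
apply: (cycle_contract (Inv := Inv)) cs.
- move=> x y xt sxy; have [] := step_turning sxy xt; split=> //; last by exists x.
  by case/and4P: sxy.
- move=> x y z [xi [w swy] ry Ey] yt syz.
  rewrite /Inv; have [-> ->] := step_straight syz (step_neq_cut gp swy) yt.
  by split=> //; exists y.
- move=> x y xt yt [xi [w /and4P[_ yi _ _]] ry Ey]; exact: step_renorm.
Qed.

Lemma path_unrenorm X T : path (step g') X T ->
  exists q, [/\ path (step g) (unrenorm n g X) q,
    last (unrenorm n g X) q = unrenorm n g (last X T) & T != [::] -> q != [::]].
Proof.
elim: T X => [|Y T IH] X /=; first by exists [::].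
case/andP=> /step_unrenorm[q pq] /IH[q' [pq' lq' _]].
exists (rcons q (unrenorm n g Y) ++ q'); split.
- by rewrite cat_path pq last_rcons.
- by rewrite last_cat last_rcons.
- by move=> _; case: (q).
Qed.

(** Joining the straight runs over all steps of [t] gives a closed path that may
    repeat itself.  A simple cycle through one of its turning points is enough: the
    contraction of that cycle meets [t], and the new steps are deterministic. *)
Lemma ucycle_expand t : t != [::] -> ucycle (step g') t ->
  exists2 s, ucycle (step g) s & exists i, t = rot i (turn_states s).
Proof.
case: t => // X T _ ct; have/andP[/= cX _] := ct.
have [q [pq lq qn]] := path_unrenorm cX.
have Xi : inside g' X by move: cX; case: (T) => [|Y T'] /=; case/andP => /and4P[].
have {qn} : q != [::] by apply: qn; case: (T).
move: pq lq; rewrite last_rcons; case/lastP: q => // q x pq; rewrite last_rcons => Ex _.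
rewrite Ex in pq; have [s us xs] := ucycle_of_return pq.
exists s => //; have us' := ucycle_contract us.
apply: (ucycle_deterministic_rot (step_deterministic gp') us' ct (x := X)) (mem_head _ _).
apply/mapP; exists (unrenorm n g X); last by rewrite unrenormK.
by rewrite mem_filter xs unrenorm_turning.
Qed.

Lemma reduction_turning (lab : nat -> nat) s : {in [pred p | (p <= 4)%N] &, injective lab} ->
  ucycle (step g) s ->
  reduction [seq lab x.1 | x <- s] = [seq lab x.1 | x <- s & turning g x].
Proof.
move=> lab_inj /andP[cs us].
rewrite (reduction_map (P := turning g) us) // => x xs.
have sp := prev_cycle cs xs; have sn := next_cycle cs xs.
rewrite -(turning_step gp sp sn); apply/eqP/eqP => [|->] //; apply: lab_inj.
  by case/and4P: sp => /andP[].
by case/and4P: sn => _ /andP[].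
Qed.

End Renorm.

(** * Weights of crossings *)

Section Weight.
Variables (f A B : R).
Hypothesis ff : f ^+ 2 = f + 1.

(** The overlaps for a direction of the third sector, [f] being the golden ratio;
    [A] and [B] vanish at the two ends of the sector. *)
Definition golden_gaps (f A B : R) := Gaps A (f * B) (f * A) B.

(** These linear maps have determinant -1.  Both components are positive exactly
    when the direction lies inside the n-th sub-arc. *)
Definition new_dir (n : nat) (A B : R) : R * R :=
  match n with
  | 0 => (B - f * A, A)
  | 1 => (f * (B - A), f * A - B)
  | 2 => (f * B - A, f * (A - B))
  | _ => (B, A - f * B)
  end.

Lemma new_golden_gaps n :
  new_gaps n (golden_gaps f A B) =
  golden_gaps f (new_dir n A B).1 (new_dir n A B).2.
Proof. by case: n => [|[|[|n]]] /=; congr Gaps; ring: ff. Qed.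

(** Up to a factor that depends only on the direction, this is the contribution of
    one crossing to the length of a closed trajectory; see [chord_len_flip]. *)
Definition weight (p : nat) : R := nth 0 [:: 1 - f; f; 0; f; 1 - f] p.

Definition total_weight (s : seq state) : R := \sum_(x <- s) weight x.1.

(** Its differences along the walk cancel over a cycle; at a straight passage they
    make up for the crossing that is dropped, at a turn for the change of weight. *)
Definition weight_potential (n p : nat) : R :=
  nth 0 (nth [::] [:: [:: 0; 0; 0; - f; 1 - f]; [:: 0; 0; f; f - 1; 2 * f - 1];
     [:: 0; 0; 1 - f; 1 - f; 1 - 2 * f]; [:: 0; 0; f - 1; f; f - 1]] n) p.

(** Consecutive projections add up to twice a midpoint, hence the alternating sum
    of the midpoints over a cycle telescopes; the constant term is there because a
    cycle has as many top crossings as bottom ones. *)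
Definition weight_drift (n : nat) (x : state) : R :=
  (-1) ^+ odd x.1 * (nth 0 [:: 1; 2 - f; f - 2; -1] n * x.2 +
    nth 0 [:: - A; (f - 1) * A + B; (2 - f) * A; f * A + (f - 1) * B] n).

Let g := golden_gaps f A B.

(** Up to terms that cancel along a cycle, the new weight of the turning points is
    a fixed multiple of the weight of all crossings. *)
Lemma weight_turning n x0 x x1 :
  (n <= 3)%N -> gaps_pos g -> gaps_pos (new_gaps n g) ->
  step g x0 x -> step g x x1 ->
  (A + B) * (if turning g x then weight (new_pos n x.1) else 0) -
    ((new_dir n A B).1 + (new_dir n A B).2) * weight x.1 =
  weight_drift n x - weight_drift n x1 +
    (A + B) * ((weight_potential n x0.1 - weight_potential n x.1) +
      (weight_potential n x1.1 - weight_potential n x.1)).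
Proof.
move=> n3 gp gp' s0 s1; rewrite -(turning_step gp s0 s1).
have E : x0.1 == x1.1 -> (x.1 == x0.1.+1) = turns_rightward n x.1.
  rewrite (turning_step gp s0 s1) => xt.
  rewrite -(turning_rightward n3 gp gp') //; last by case/and4P: s1.
  rewrite /rightward; have [_ _ _ [] [-> /andP[h1 h2]]] := stepP gp s0.
    by rewrite ltn_eqF ?ltnS ?leqnSn // (lt_gtF h1).
  by rewrite eqxx h2.
move/stepP: s1 => /(_ gp)[/andP[p4 _] /andP[q4 _] E1 H1].
move/stepP: s0 => /(_ gp)[/andP[q0 _] _ _ H0].
have {}H0 : x0.1 = x.1.+1 \/ x.1 = x0.1.+1 by case: H0 => -[-> _]; [left | right].
have {}H1 : x.1 = x1.1.+1 \/ x1.1 = x.1.+1 by case: H1 => -[-> _]; [left | right].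
move: E E1 H0 H1 p4 q0 q4; rewrite /weight_drift /weight_potential /weight; clear gp gp'.
case: x0 x x1 => p0 y0 [p y] [p1 y1] /= E -> H0 H1 p4 q0 q4 {y1 y0}.
case: n n3 E => [|[|[|[|]]]] // _; case: p H0 H1 p4 => [|[|[|[|[|]]]]] //.
all: case=> H0 [] H1; move: q0 q4; (try case: H0 => H0); (try case: H1 => H1); try subst p0;
  try subst p1; rewrite //= => _ _ _ E; try (by have := E isT).
all: rewrite /flip /lower /upper /=; ring: ff.
Qed.

Lemma total_weight_contract n s :
  (n <= 3)%N -> gaps_pos g -> gaps_pos (new_gaps n g) -> ucycle (step g) s ->
  (A + B) * total_weight (turn_states n g s) =
  ((new_dir n A B).1 + (new_dir n A B).2) * total_weight s.
Proof.
move=> n3 gp gp' /andP[cs us]; apply/eqP; rewrite -subr_eq0.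
rewrite /total_weight /turn_states big_map big_filter big_mkcond !mulr_sumr -sumrB.
rewrite (eq_big_seq (fun x => weight_drift n x - weight_drift n (next s x) +
    (A + B) * ((weight_potential n (prev s x).1 - weight_potential n x.1) +
      (weight_potential n (next s x).1 - weight_potential n x.1)))); last first.
  by move=> x xs; rewrite -weight_turning // ?prev_cycle ?next_cycle.
have sum_next (h : state -> R) : \sum_(x <- s) h (next s x) = \sum_(x <- s) h x.
  by rewrite -(big_map (next s) predT) /=; apply: perm_big; exact: map_next_perm.
have sum_prev (h : state -> R) : \sum_(x <- s) h (prev s x) = \sum_(x <- s) h x.
  by rewrite -(big_map (prev s) predT) /=; apply: perm_big; exact: map_prev_perm.
rewrite big_split /= sumrB sum_next subrr add0r -mulr_sumr big_split /= !sumrB.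
by rewrite (sum_next (fun x => weight_potential n x.1))
  (sum_prev (fun x => weight_potential n x.1)) !subrr addr0 mulr0.
Qed.
End Weight.

End Flip.

(** * The sides of the regular pentagon *)

Section Pentagon.
Variable R : realType.
Local Notation f := (golden R).
Local Notation s36 := (sin (pi / 5) : R).

Lemma golden_sqr : f ^+ 2 = f + 1.
Proof.
have s5 : Num.sqrt 5 ^+ 2 = 5 :> R by rewrite sqr_sqrtr // ler0n.
rewrite /golden expr2; move: s5; rewrite expr2; move: (Num.sqrt _) => q Hq; lra.
Qed.

Lemma golden_gt1 : 1 < f.
Proof.
have s5 : 1 < Num.sqrt 5 :> R by rewrite -[ltLHS]sqrtr1 ltr_sqrt //; lra.
by rewrite /golden; lra.
Qed.

Lemma s36_gt0 : 0 < s36.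
Proof. by apply: sin_gt0_pi; have := pi_gt0 R; lra. Qed.

(** For t = pi / 5 the equation cos (3 t) = - cos (2 t) is a cubic one in cos t, with
    the root -1 and two others, of which only f / 2 is positive. *)
Lemma cos36 : cos (pi / 5) = f / 2.
Proof.
set t := pi / 5; have c0 : 0 < cos t by apply: cos_gt0_pihalf; have := pi_gt0 R; rewrite /t;
  lra.
have E : cos (t *+ 2 + t) = - cos (t *+ 2).
  have -> : t *+ 2 + t = - (t *+ 2) + pi by rewrite /t; field.
  by rewrite cosDpi cosN.
move: E; rewrite cosD cos_mulr2n sin_mulr2n => E.
have := cos2Dsin2 t; move: E c0; move: (cos t) (sin t) => c s E c0 cs.
have Hc : (2 * c) ^+ 2 = 2 * c + 1.
  have : (c + 1) * (4 * c ^+ 2 - 2 * c - 1) = 0.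
    have cs' : s ^+ 2 = 1 - c ^+ 2 by lra.
    have := congr1 (fun z => c * z) cs'; lra.
  move/eqP; rewrite mulf_eq0 => /orP[/eqP|/eqP] h; lra.
have : (2 * c - f) * (2 * c + f - 1) = 0 by ring: Hc golden_sqr.
have := golden_gt1; move/[swap]/eqP; rewrite mulf_eq0 => /orP[/eqP|/eqP]; lra.
Qed.

Lemma side_vecE (k : nat) : (k < 5)%N ->
  side_vec R k = nth 0 [:: (1, 0); ((f - 1) / 2, f * s36); (- f / 2, s36);
    (- f / 2, - s36); ((f - 1) / 2, - (f * s36))] k.
Proof.
have E k' : 2 * pi * k'%:R / 5 = (pi / 5) *+ 2 *+ k' :> R.
  by rewrite -mulr_natr -mulr_natr; field.
have c2 : cos ((pi / 5) *+ 2) = (f - 1) / 2 :> R.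
  by rewrite cos_mulr2n cos36; field: golden_sqr.
have s2 : sin ((pi / 5) *+ 2) = f * s36 :> R.
  by rewrite sin_mulr2n cos36; field.
rewrite /side_vec E; case: k => [|[|[|[|[|]]]]] //= _.
- by rewrite mulr0n cos0 sin0.
- by rewrite mulr1n c2 s2.
- have -> : (pi / 5) *+ 2 *+ 2 = - (pi / 5) + pi :> R by field.
  by rewrite cosDpi sinDpi cosN sinN opprK cos36 mulNr.
- have -> : (pi / 5) *+ 2 *+ 3 = pi / 5 + pi :> R by field.
  by rewrite cosDpi sinDpi cos36 mulNr.
- have -> : (pi / 5) *+ 2 *+ 4 = - ((pi / 5) *+ 2) + pi *+ 2 :> R by field.
  by rewrite cosD2pi sinD2pi cosN sinN c2 s2.
Qed.

Lemma vertexE (k : nat) : (k <= 5)%N ->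
  vertex R k = nth 0 [:: (0, 0); (1, 0); ((f + 1) / 2, f * s36); (1 / 2, (f + 1) * s36);
    ((1 - f) / 2, f * s36); (0, 0)] k.
Proof.
have addE (a b c d : R) : (a, b) + (c, d) = (a + c, b + d) by [].
by case: k => [|[|[|[|[|[|]]]]]] // _;
  rewrite /vertex ?big_ord0 // !big_ord_recr big_ord0 /= !side_vecE //= ?add0r ?addE;
    congr pair; rewrite /=; lra.
Qed.
End Pentagon.

Section Coding.
Variable R : realType.
Local Notation f := (golden R).
Local Notation s36 := (sin (pi / 5) : R).
Local Notation state := (state R).
Local Notation gaps := (gaps R).

Definition side_index (p : nat) : 'I_5 := inord (nth 0 [:: 4; 3; 0; 2; 1] p)%N.
Definition side_pos (k : nat) : nat := nth 0 [:: 2; 4; 3; 1; 0]%N k.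
Definition pos_label (p : nat) : nat := nth 0 [:: 1; 4; 3; 2; 5]%N p.

Lemma val_side_index p : val (side_index p) = nth 0%N [:: 4; 3; 0; 2; 1]%N p.
Proof. by rewrite /= inordK //; case: p => [|[|[|[|[|p]]]]]; rewrite //= nth_nil. Qed.

Lemma side_label_index p : (p <= 4)%N -> side_label (side_index p) = pos_label p.
Proof. by rewrite /side_label val_side_index; case: p => [|[|[|[|[|p]]]]]. Qed.

Lemma side_posK (k : 'I_5) : side_index (side_pos k) = k.
Proof. by apply/val_inj; rewrite val_side_index; case: k => [[|[|[|[|[|]]]]]]. Qed.

Lemma side_indexK p : (p <= 4)%N -> side_pos (side_index p) = p.
Proof. by rewrite val_side_index; case: p => [|[|[|[|[|p]]]]]. Qed.

Lemma side_pos_le4 (k : 'I_5) : (side_pos k <= 4)%N.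
Proof. by case: k => [[|[|[|[|[|]]]]]]. Qed.

(** Counterclockwise, the bottom sides run from left to right and the top sides from
    right to left. *)
Definition side_param (g : gaps) (x : state) : R :=
  (if odd x.1 then upper g x.1 - x.2 else x.2 - lower g x.1) / (upper g x.1 - lower g x.1).

Definition side_point (g : gaps) (x : state) : R * R :=
  vertex R (side_index x.1) + side_param g x *: side_vec R (side_index x.1).

(** The flag [b] is set when the direction points downwards.  An ascending trajectory
    leaves P through a top side and P' through the copy of a bottom side, so that
    the sheet is determined by the position. *)
Definition sheet (b : bool) (p : nat) : bool := ~~ odd p (+) b.

Definition cross (g : gaps) (b : bool) (x : state) : crossing R :=
  (sheet b x.1, side_index x.1, (-1) ^+ sheet b x.1 *: side_point g x).

Definition height (v : R * R) : R := v.2 / s36.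

Variables (A B x : R).
Hypotheses (A0 : 0 < A) (B0 : 0 < B) (xAB : x * (2 * f ^+ 2 * (A + B)) = B - A).
Let g := golden_gaps f A B.
Let f0 : 0 < f. Proof. by have := golden_gt1 R; lra. Qed.
Let ff : f * f = f + 1. Proof. exact: golden_sqr. Qed.

Lemma golden_gaps_pos : gaps_pos g.
Proof. by rewrite /gaps_pos /= A0 B0 !mulr_gt0. Qed.

(** The linear form that vanishes on the direction with abscissa x, scaled so that
    up to the constant [A] it maps the sides onto the intervals of [g]. *)
Definition across (v : R * R) : R := f * (A + B) * v.1 + (B - A) * (f - 1) / 2 * height v.

Lemma acrossD u v : across (u + v) = across u + across v.
Proof. by case: u v => u1 u2 [v1 v2]; rewrite /across /height /=; ring. Qed.

Lemma acrossZ a v : across (a *: v) = a * across v.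
Proof. by case: v => v1 v2; rewrite /across /height /= /GRing.scale /=; ring. Qed.

Lemma heightD u v : height (u + v) = height u + height v.
Proof. by case: u v => u1 u2 [v1 v2]; rewrite /height /=; ring. Qed.

Lemma heightZ a v : height (a *: v) = a * height v.
Proof. by case: v => v1 v2; rewrite /height /= /GRing.scale /=; ring. Qed.

Lemma across_height_inj u v : across u = across v -> height u = height v -> u = v.
Proof.
case: u v => u1 u2 [v1 v2]; rewrite /across /height /= => H.
move/(mulIf (invr_neq0 (lt0r_neq0 (s36_gt0 R)))) => E; congr pair => //.
have h : 0 < f * (A + B) by rewrite mulr_gt0 // addr_gt0.
by rewrite E in H; move/addIr: H; apply: (mulfI (lt0r_neq0 h)).
Qed.

Lemma upper_lower p : (p <= 4)%N -> 0 < upper g p - lower g p.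
Proof.
have := golden_gaps_pos; rewrite /g /upper /lower /= => /and4P[/= h0 h1 h2 h3].
by case: p => [|[|[|[|[|p]]]]] //= _; lra.
Qed.

Lemma vertex_side_index p : (p <= 4)%N -> vertex R (side_index p) =
  nth (0, 0) [:: ((1 - f) / 2, f * s36); (1 / 2, (f + 1) * s36); (0, 0);
    ((f + 1) / 2, f * s36); (1, 0)] p.
Proof.
rewrite vertexE; last exact: ltnW (ltn_ord _).
by rewrite val_side_index; case: p => [|[|[|[|[|p]]]]].
Qed.

Lemma side_vec_side_index p : (p <= 4)%N -> side_vec R (side_index p) =
  nth (0, 0) [:: ((f - 1) / 2, - (f * s36)); (- f / 2, - s36); (1, 0);
    (- f / 2, s36); ((f - 1) / 2, f * s36)] p.
Proof.
by rewrite side_vecE // val_side_index; case: p => [|[|[|[|[|p]]]]].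
Qed.

Lemma vertex_side_index_succ p :
  vertex R (side_index p).+1 = vertex R (side_index p) + side_vec R (side_index p).
Proof. by rewrite /vertex big_ord_recr. Qed.

Lemma height_side_point y : (y.1 <= 4)%N -> height (side_point g y) =
  nth 0 [:: f; f + 1; 0; f; 0] y.1 + side_param g y * nth 0 [:: - f; -1; 0; 1; f] y.1.
Proof.
have s0 := lt0r_neq0 (s36_gt0 R).
move=> y4; rewrite /side_point heightD heightZ vertex_side_index // side_vec_side_index //.
move: (side_param _ _) => u; case: y y4 => p y /=.
by case: p => [|[|[|[|[|p]]]]] //= _; rewrite /height /=; field.
Qed.

Lemma across_side_point y : (y.1 <= 4)%N -> across (side_point g y) + A = y.2.
Proof.
have s0 := lt0r_neq0 (s36_gt0 R).
move=> y4; have := upper_lower y4.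
rewrite /side_point acrossD acrossZ vertex_side_index // side_vec_side_index //.
rewrite /side_param /upper /lower; case: y y4 => p y /=.
case: p => [|[|[|[|[|p]]]]] //= _; rewrite /across /height /= => h;
 field: ff; rewrite s0 /= lt0r_neq0 //; lra.
Qed.

Definition flip_state (y : state) : state := (y.1, flip g y.1 y.2).

Lemma inside_flip_state y : inside g y -> inside g (flip_state y).
Proof. by rewrite /inside /flip_state /flip /= => /andP[-> ]; lra. Qed.

Lemma side_param_bounds y : inside g y -> 0 < side_param g y < 1.
Proof.
case/andP=> y4 /andP[h1 h2]; have h := upper_lower y4.
by rewrite /side_param ltr_pdivlMr // ltr_pdivrMr // mul0r mul1r; case: ifP => _; lra.
Qed.

Lemma side_param_flip y : (y.1 <= 4)%N -> side_param g (flip_state y) = 1 - side_param g y.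
Proof.
move=> y4; have h := lt0r_neq0 (upper_lower y4).
by rewrite /side_param /flip_state /flip /=; case: ifP => _; field.
Qed.

Lemma side_point_flip y : (y.1 <= 4)%N ->
  vertex R (side_index y.1) + vertex R (side_index y.1).+1 - side_point g y =
  side_point g (flip_state y).
Proof.
move=> y4; rewrite vertex_side_index_succ // /side_point side_param_flip // scalerBl scale1r.
by rewrite opprD addrACA addrA addrN add0r addrA.
Qed.

(** Heights are measured in units of sin 36; the leftmost and the rightmost vertex of
    P have height f, and they separate the bottom from the top. *)
Lemma height_even y : inside g y -> ~~ odd y.1 -> height (side_point g y) < f.
Proof.
move=> yi; have /andP[u0 u1] := side_param_bounds yi.
move/andP: yi => [y4 _]; rewrite height_side_point //.
have := f0; move: (side_param _ _) u0 u1 => u u0 u1 h; case: y y4 => p y /=.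
by case: p => [|[|[|[|[|p]]]]] //= _ _; nra.
Qed.

Lemma height_odd y : inside g y -> odd y.1 -> f < height (side_point g y).
Proof.
move=> yi; have /andP[u0 u1] := side_param_bounds yi.
move/andP: yi => [y4 _]; rewrite height_side_point //.
have := f0; move: (side_param _ _) u0 u1 => u u0 u1 h; case: y y4 => p y /=.
by case: p => [|[|[|[|[|p]]]]] //= _ _; nra.
Qed.

Lemma inside_same_parity p q z : inside g (p, z) -> inside g (q, z) -> odd p = odd q -> p = q.
Proof.
have := golden_gaps_pos; rewrite /g /inside /upper /lower /= => /and4P[/= h0 h1 h2 h3].
by case: p => [|[|[|[|[|p]]]]] //=; case: q => [|[|[|[|[|q]]]]] //= H H' _; exfalso; lra.
Qed.

Lemma on_side_cross b y : inside g y ->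
  on_side (cross g b y).1.1 (crossing_side (cross g b y)) (exit_point (cross g b y)).
Proof. by move=> yi; exists (side_param g y); split; [exact: side_param_bounds |]. Qed.

Lemma side_point_exists k u : 0 < u < 1 -> exists2 y, inside g y &
  side_index y.1 = k /\ vertex R k + u *: side_vec R k = side_point g y.
Proof.
move=> /andP[u0 u1]; have p4 := side_pos_le4 k; have h := upper_lower p4.
pose p := side_pos k; rewrite -/p in p4 h.
pose y := if odd p then upper g p - u * (upper g p - lower g p)
          else lower g p + u * (upper g p - lower g p).
exists (p, y).
  by rewrite /inside /= p4 /= /y; case: ifP => _; nra.
split; first exact: side_posK.
rewrite /side_point /= side_posK; congr (_ + _ *: _).
by rewrite /side_param /= /y; case: (odd p); field; rewrite lt0r_neq0.
Qed.

Section Direction.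
Variable d : R * R.
Hypotheses (d2 : d.2 != 0) (across_d : across d = 0).

(** A chord from the bottom to the top ascends; this recovers the sense of the motion
    from the positions. *)
Lemma chord_step a y y' : inside g y -> inside g y' -> y'.1 != y.1 ->
  side_point g y' = side_point g (flip_state y) + a *: d ->
  step g y y' /\ (0 < a * d.2) = odd y'.1.
Proof.
move=> yi yi' np E; have fi := inside_flip_state yi.
have y4 : (y.1 <= 4)%N by case/andP: yi.
have y4' : (y'.1 <= 4)%N by case/andP: yi'.
have E2 : y'.2 = flip g y.1 y.2.
  rewrite -(across_side_point y4') E acrossD acrossZ across_d mulr0 addr0.
  exact: (@across_side_point (flip_state y)).
have od : odd y'.1 != odd y.1.
  apply: contraNN np => /eqP od; apply/eqP; apply: inside_same_parity od.
    by move: yi'; rewrite {1}(surjective_pairing y') E2; exact: id.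
  by [].
split; first by rewrite /step yi yi' od E2 eqxx.
have Eh : height (side_point g y') - height (side_point g (flip_state y)) = a * d.2 / s36.
  by rewrite E heightD heightZ /height; ring.
have -> : (0 < a * d.2) = (0 < a * d.2 / s36) by rewrite [RHS]pmulr_lgt0 // invr_gt0 s36_gt0.
rewrite -Eh subr_gt0.
have [hodd|hodd] := boolP (odd y'.1).
  apply: lt_trans (height_odd yi' hodd); apply: height_even => //=.
  by move: od; rewrite hodd; case: odd.
apply/negbTE; rewrite -leNgt ltW //; apply: lt_trans (height_even yi' hodd) _.
apply: height_odd => //=.
by move: od; rewrite (negbTE hodd); case: odd.
Qed.

Lemma step_chord y y' : step g y y' -> exists a,
  [/\ side_point g y' = side_point g (flip_state y) + a *: d,
   (0 < a * d.2) = odd y'.1 & a != 0].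
Proof.
case/and4P=> yi yi' od /eqP E2.
have y4 : (y.1 <= 4)%N by case/andP: yi.
have y4' : (y'.1 <= 4)%N by case/andP: yi'.
have s0 := lt0r_neq0 (s36_gt0 R).
pose a := (height (side_point g y') - height (side_point g (flip_state y))) * s36 / d.2.
have E : side_point g y' = side_point g (flip_state y) + a *: d.
  apply: across_height_inj; last by rewrite heightD heightZ [height d]/height /a; field;
    rewrite s0 d2.
  rewrite acrossD acrossZ across_d mulr0 addr0; apply: (addIr A).
  by rewrite across_side_point // (@across_side_point (flip_state y)).
exists a; have np : y'.1 != y.1 by apply: contraNN od => /eqP->.
have [_ ap] := chord_step yi yi' np E; split=> //.
apply: contraNneq od => a0.
have E0 : side_point g y' = side_point g (flip_state y) by rewrite E a0 scale0r addr0.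
have fi := inside_flip_state yi.
have Eh := congr1 height E0.
case hodd: (odd y'.1); case o: (odd y.1) => //; exfalso.
  have := height_odd yi' hodd; have := height_even fi; rewrite /= o => /(_ isT); lra.
have := height_odd fi o; have := height_even yi'; rewrite hodd => /(_ isT); lra.
Qed.
End Direction.
End Coding.

(** * Closed trajectories as cycles of flips *)

Lemma next_map_in (S T : eqType) (h : S -> T) (s : seq S) :
  uniq (map h s) -> {in s, forall x, next (map h s) (h x) = h (next s x)}.
Proof.
move=> us; have us' := map_uniq us; apply/eq_in_map.
rewrite (map_comp h (next s)) -rot1_next // map_rot rot1_next //.
by rewrite -map_comp.
Qed.

Section Trajectories.
Variable R : realType.
Local Notation f := (golden R).
Local Notation s36 := (sin (pi / 5) : R).
Local Notation state := (state R).
Variables (A B x : R).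
Hypotheses (A0 : 0 < A) (B0 : 0 < B) (xAB : x * (2 * f ^+ 2 * (A + B)) = B - A).
Let g := golden_gaps f A B.
Let f0 : 0 < f. Proof. by have := golden_gt1 R; lra. Qed.
Let ff : f * f = f + 1. Proof. exact: golden_sqr. Qed.
Let s0 : s36 != 0. Proof. exact: lt0r_neq0 (s36_gt0 R). Qed.

Lemma across_direction d : has_direction x d -> d.2 != 0 /\ across A B d = 0.
Proof.
case=> t [t0 xt ->]; split=> //; rewrite /across /height /=.
have -> : B - A = x * (2 * f ^+ 2 * (A + B)) by [].
rewrite xt; field: ff; exact/andP.
Qed.

Lemma direction_exists b : exists d : R * R, has_direction x d /\ (d.2 < 0) = b.
Proof.
pose a := atan (x / s36); have ca : 0 < cos a.
  by apply: cos_gt0_pihalf; rewrite atan_gtNpi2 atan_ltpi2.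
have ta : x = s36 * (sin a / cos a).
  by have := atanK (x / s36); rewrite -/a /tan => ->; field.
have ca0 := lt0r_neq0 ca.
case: b.
  exists (cos (a + pi / 2 + pi), sin (a + pi / 2 + pi));
    rewrite /= sinDpi sinDpihalf oppr_lt0 ca.
  split=> //; exists (a + pi / 2 + pi); rewrite sinDpi sinDpihalf cosDpi cosDpihalf oppr_eq0.
  by split=> //; rewrite ta; field.
exists (cos (a + pi / 2), sin (a + pi / 2)); rewrite /= sinDpihalf ltNge ltW //.
split=> //; exists (a + pi / 2); rewrite sinDpihalf cosDpihalf; split=> //.
by rewrite ta; field.
Qed.

Lemma signb_addN (b : bool) (v : R * R) : - ((-1) ^+ b *: v) = (-1) ^+ (~~ b) *: v.
Proof. by rewrite -scaleNr; case: b; rewrite /= ?expr0 ?expr1 ?opprK. Qed.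

Lemma entry_cross b y : (y.1 <= 4)%N -> entry_point (cross g b y) =
  (-1) ^+ (~~ sheet b y.1) *: side_point g (flip_state A B y).
Proof.
move=> y4; rewrite /entry_point /Defs.glue /cross /= -scalerBr -signb_addN -scalerN;
  congr (_ *: _).
by rewrite -side_point_flip // opprB.
Qed.

Lemma sign_move (b : bool) (t : R) (u v d : R * R) :
  (-1) ^+ b *: u = (-1) ^+ b *: v + t *: d -> u = v + ((-1) ^+ b * t) *: d.
Proof.
move/(congr1 (fun z => (-1) ^+ b *: z)); rewrite scalerDr !scalerA.
by rewrite -signr_addb addbb expr0 !scale1r.
Qed.

Lemma sheet_sign p (a r : R) : (0 < a * r) = odd p -> a != 0 -> r != 0 ->
  0 < (-1) ^+ sheet (r < 0) p * a.
Proof.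
move=> + /eqP a0 /eqP r0; rewrite /sheet; case: (odd p); case: (ltgtP r 0) => // r1.
- by rewrite /= expr1; nra.
- by rewrite /= expr0; nra.
- by move/negbT; rewrite -leNgt /= expr0 => h; case: (ltgtP a 0) a0 => // a1 _; nra.
- by move/negbT; rewrite -leNgt /= expr1 => h; case: (ltgtP a 0) a0 => // a1 _; nra.
Qed.

Lemma sheet_unique p (b : bool) (t r : R) : 0 < t -> r != 0 ->
  (0 < (-1) ^+ b * t * r) = odd p -> sheet (r < 0) p = b.
Proof.
rewrite /sheet => t0 /eqP r0 <-; case: b; rewrite ?expr0 ?expr1; case: (ltgtP r 0) => // r1.
- by rewrite addbT negbK; apply/idP; nra.
- by rewrite addbF; apply/negP; nra.
- by rewrite addbT negbK; apply/negP; nra.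
- by rewrite addbF; apply/negbF; nra.
Qed.

Section Direction.
Variable d : R * R.
Hypothesis xd : has_direction x d.

Lemma next_cross y y' : inside g y -> inside g y' ->
  next_crossing d (cross g (d.2 < 0) y) (cross g (d.2 < 0) y') <-> step g y y'.
Proof.
have [d2 ad] := across_direction xd.
move=> yi yi'; have y4 : (y.1 <= 4)%N by case/andP: yi.
split.
  case; rewrite /cross /crossing_side /exit_point /= => Es sk _ [t [t0]].
  rewrite -/(cross g _ y) entry_cross // -Es => /sign_move E.
  have np : y'.1 != y.1 by apply: contraNneq sk => ->.
  by have [] := chord_step A0 B0 ad yi yi' np E.
move=> sy; have [a [E ap a0]] := step_chord A0 B0 d2 ad sy.
have od : odd y'.1 = ~~ odd y.1 by case/and4P: sy => _ _; case: odd; case: odd.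
have Es : sheet (d.2 < 0) y'.1 = ~~ sheet (d.2 < 0) y.1 by rewrite /sheet od addNb.
split => //.
- apply/eqP => /(congr1 (fun k : 'I_5 => side_pos k)); rewrite /cross /crossing_side /=.
  rewrite !side_indexK //; last by case/andP: yi'.
  by move=> Ey; move: od; rewrite Ey; case: odd.
- exact: on_side_cross.
exists ((-1) ^+ sheet (d.2 < 0) y'.1 * a); split; last first.
  rewrite entry_cross // -Es {1}/exit_point /= E scalerDr scalerA //.
exact: sheet_sign.
Qed.

Lemma next_crossing_decode c c' : on_side c.1.1 c.1.2 c.2 -> next_crossing d c c' ->
  exists2 y, inside g y & c' = cross g (d.2 < 0) y.
Proof.
have [d2 ad] := across_direction xd.
case: c c' => [[sh k] p] [[sh' k'] p'] [u [u01 /= Ep]].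
have [y yi [Ek Ey]] := side_point_exists A0 B0 k u01.
case; rewrite /crossing_side /exit_point /= => Es sk [u' [u01' Ep']] [t [t0 Ed]].
have [y' yi' [Ek' Ey']] := side_point_exists A0 B0 k' u01'.
have y4 : (y.1 <= 4)%N by case/andP: yi.
exists y' => //.
have E : side_point g y' = side_point g (flip_state A B y) + ((-1) ^+ sh' * t) *: d.
  apply: sign_move; rewrite -Ey' -Ep' Ed; congr (_ + _).
  rewrite /entry_point /Defs.glue /= Ep Ey -scalerBr Es -signb_addN -scalerN; congr (_ *: _).
  by rewrite -side_point_flip // opprB Ek.
have np : y'.1 != y.1 by apply: contraNneq sk => Ep1; rewrite -Ek -Ek' Ep1.
have [_ od] := chord_step A0 B0 ad yi yi' np E.
rewrite /cross Ek' -Ey' Ep'; suff -> : sheet (d.2 < 0) y'.1 = sh' by [].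
exact: sheet_unique od.
Qed.

(** With this sign, the difference of heights along a chord is the sum of one term
    for each of its two ends. *)
Definition chord_len (y : state) : R := (-1) ^+ (~~ odd y.1) * height (side_point g y).

Lemma dist_cross y y' : step g y y' ->
  euclid_dist (entry_point (cross g (d.2 < 0) y)) (exit_point (cross g (d.2 < 0) y')) =
  (chord_len y' + chord_len (flip_state A B y)) * (s36 / `|d.2|).
Proof.
have [d2 ad] := across_direction xd => sy.
have [a [E ap a0]] := step_chord A0 B0 d2 ad sy.
have y4 : (y.1 <= 4)%N by case/and4P: sy => /andP[].
have od : odd y'.1 = ~~ odd y.1 by case/and4P: sy => _ _; case: odd; case: odd.
have Es : sheet (d.2 < 0) y'.1 = ~~ sheet (d.2 < 0) y.1 by rewrite /sheet od addNb.
have -> : euclid_dist (entry_point (cross g (d.2 < 0) y)) (exit_point (cross g (d.2 < 0) y'))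
    = `|a|.
  rewrite entry_cross // -Es /exit_point /= E.
  case: xd => t [_ _ ->]; move: (side_point _ _) => [v1 v2].
  rewrite /euclid_dist /= /GRing.scale /=.
  set e := (-1) ^+ _; have e2 : e ^+ 2 = 1 by rewrite sqrr_sign.
  have -> : (e * v1 - e * (v1 + a * cos t)) ^+ 2 + (e * v2 - e * (v2 + a * sin t)) ^+ 2 = a ^+
    2.
    transitivity (e ^+ 2 * a ^+ 2 * (cos t ^+ 2 + sin t ^+ 2)); first by ring.
    by rewrite e2 cos2Dsin2 mul1r mulr1.
  by rewrite sqrtr_sqr.
have Eh : height (side_point g y') - height (side_point g (flip_state A B y)) = a * d.2 / s36.
  by rewrite E heightD heightZ /height; ring.
have -> : chord_len y' + chord_len (flip_state A B y) = `|a * d.2| / s36.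
  rewrite /chord_len /= od negbK.
  have -> : `|a * d.2| = (-1) ^+ odd y.1 * (a * d.2).
    move: ap; rewrite od; case: (odd y.1) => /=; rewrite ?expr0 ?expr1 => h.
      by rewrite ler0_norm ?mulN1r // leNgt h.
    by rewrite mul1r gtr0_norm.
  rewrite -mulrA -Eh; case: (odd y.1); rewrite /= ?expr0 ?expr1; ring.
have nd : `|d.2| != 0 by rewrite normr_eq0.
by rewrite normrM; field; rewrite s0 nd.
Qed.

(** A crossing contributes the heights of its point and of the flipped point, whose
    sum is the sum of the heights of the ends of the side. *)
Lemma chord_len_flip y : (y.1 <= 4)%N ->
  chord_len y + chord_len (flip_state A B y) = f ^+ 2 * weight f y.1.
Proof.
move=> y4; rewrite /chord_len !height_side_point // side_param_flip //.
move: (side_param g y) => u; case: y y4 => [[|[|[|[|[|p]]]]] z] //= _; rewrite /weight /=;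
  ring: ff.
Qed.

Lemma direction_slope : s36 / `|d.2| = Num.sqrt (s36 ^+ 2 + x ^+ 2).
Proof.
have [t [t0 xt ->]] := xd => /=.
have -> : s36 ^+ 2 + x ^+ 2 = (s36 / sin t) ^+ 2.
  by rewrite xt; have := cos2sin2 t; move: (cos t) (sin t) t0 => c z z0 cz; field: cz.
by rewrite sqrtr_sqr normrM normfV (gtr0_norm (s36_gt0 R)).
Qed.
End Direction.

Definition decode (c : crossing R) : state :=
  (side_pos c.1.2, across A B ((-1) ^+ c.1.1 *: c.2) + A).

Lemma decodeK b y : (y.1 <= 4)%N -> decode (cross g b y) = y.
Proof.
move=> y4; rewrite /decode /= side_indexK // scalerA -signr_addb addbb expr0 scale1r.
by rewrite across_side_point // -surjective_pairing.
Qed.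

(** The states and the orientation [b] suffice, since they determine the sheets. *)
Lemma closed_trajectory_coding gs : closed_trajectory x gs <->
  exists b s, [/\ s <> [::], ucycle (step g) s & gs = map (cross g b) s].
Proof.
split.
  case=> gs0 [d [xd /andP[cg ug]]].
  have os : {in gs, forall c : crossing R, on_side c.1.1 c.1.2 c.2}.
    by move=> c cgs; have /asboolP[_ _ + _] := prev_cycle cg cgs.
  have dec : {in gs, forall c, exists2 y, inside g y & c = cross g (d.2 < 0) y}.
    move=> c cgs; have /asboolP := prev_cycle cg cgs; apply: next_crossing_decode => //.
    by apply: os; rewrite mem_prev.
  have decK : {in gs, forall c, inside g (decode c) /\ cross g (d.2 < 0) (decode c) = c}.
    by move=> c /dec[y yi ->]; rewrite decodeK //; case/andP: yi.
  have Eg : gs = map (cross g (d.2 < 0)) (map decode gs).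
    by rewrite -map_comp map_id_in // => c /decK[].
  exists (d.2 < 0), (map decode gs); split=> //.
    by move=> /(congr1 size); rewrite size_map => /size0nil.
  apply/andP; split; last by rewrite map_inj_in_uniq // => c c' /decK[_ {2}<-] /decK[_ {2}<-]
    ->.
  rewrite cycle_map; apply: (@sub_in_cycle _ (mem gs) _ _ _ gs _ cg); last exact/allP.
  move=> c c' /decK[ci Ec] /decK[ci' Ec'] /asboolP; rewrite -{1}Ec -{1}Ec' /=.
  by move/(next_cross xd ci ci').
case=> b [s [sn /andP[cs us] ->]]; split; first by case: s sn {cs us}.
have [d [xd db]] := direction_exists b; exists d; split=> //; subst b.
have si : {in s, forall y, inside g y} by move=> y ys; have /and4P[] := next_cycle cs ys.
apply/andP; split; last first.
  rewrite map_inj_in_uniq // => y y' /si/andP[y4 _] /si/andP[y4' _].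
  by move/(congr1 decode); rewrite !decodeK.
rewrite cycle_map; apply: (@sub_in_cycle _ (mem s) _ _ _ s _ cs); last exact/allP.
by move=> y y' /si yi /si yi' sy; apply/asboolP/(next_cross xd yi yi').
Qed.

Lemma traj_word_cross b s : ucycle (step g) s ->
  traj_word (map (cross g b) s) = [seq pos_label y.1 | y <- s].
Proof.
case/andP=> cs _; rewrite /traj_word -map_comp; apply/eq_in_map => y ys /=.
by rewrite /crossing_side side_label_index //; have /and4P[/andP[]] := next_cycle cs ys.
Qed.

Lemma total_weight_chords s : ucycle (step g) s ->
  \sum_(y <- s) (chord_len (next s y) + chord_len (flip_state A B y)) =
  f ^+ 2 * total_weight f s.
Proof.
case/andP=> cs us; rewrite big_split /= -(big_map (next s) predT) /=.
rewrite (perm_big _ (map_next_perm us)) /= -big_split /= /total_weight mulr_sumr.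
apply: eq_big_seq => y ys; rewrite chord_len_flip //.
by have /and4P[/andP[]] := next_cycle cs ys.
Qed.

Lemma chord_len_gt0 y y' : step g y y' -> 0 < chord_len y' + chord_len (flip_state A B y).
Proof.
case/and4P=> yi yi' od _; have fi := inside_flip_state yi.
have o1 : odd y'.1 = ~~ odd y.1 by move: od; case: odd; case: odd.
rewrite /chord_len /= o1 negbK; case hy: (odd y.1); rewrite /= ?expr0 ?expr1 ?mul1r ?mulN1r.
  have := height_odd A0 B0 fi hy; have := height_even A0 B0 yi'; rewrite o1 hy => /(_ isT); lra.
by have := height_odd A0 B0 yi'; rewrite o1 hy => /(_ isT);
  have := height_even A0 B0 fi (negbT hy); lra.
Qed.

Lemma traj_length_cross b s : ucycle (step g) s ->
  traj_length (map (cross g b) s) =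
  Num.sqrt (s36 ^+ 2 + x ^+ 2) * f ^+ 2 * total_weight f s.
Proof.
case/andP=> cs us; have [d [xd db]] := direction_exists b; subst b.
have si : {in s, forall y : state, (y.1 <= 4)%N}.
  by move=> y ys; have /and4P[/andP[]] := next_cycle cs ys.
rewrite /traj_length big_map.
rewrite (eq_big_seq (fun y => (chord_len (next s y) + chord_len (flip_state A B y)) *
    Num.sqrt (s36 ^+ 2 + x ^+ 2))); last first.
  move=> y ys; rewrite next_map_in //; last first.
    rewrite map_inj_in_uniq // => z z' /si z4 /si z4' /(congr1 decode).
    by rewrite !decodeK.
  by rewrite (dist_cross xd) ?next_cycle // (direction_slope xd).
by rewrite -mulr_suml total_weight_chords; [ring | apply/andP].
Qed.

Lemma total_weight_gt0 s : s <> [::] -> ucycle (step g) s -> 0 < total_weight f s.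
Proof.
move=> sn us; have/andP[cs _] := us.
rewrite -(pmulr_rgt0 _ (exprn_gt0 2 f0)) -total_weight_chords //.
have hpos : {in s, forall y, 0 < chord_len (next s y) + chord_len (flip_state A B y)}.
  by move=> y ys; apply: chord_len_gt0; apply: next_cycle.
case: s sn hpos {us cs} => [//|y s] _; move: (next _) => h hpos.
rewrite big_cons ltr_pwDl ?hpos ?mem_head // big_seq sumr_ge0 // => z zs.
by rewrite ltW // hpos // inE zs orbT.
Qed.
End Trajectories.

(** * Transfer of symbolic orbits *)

Section Transfer.
Variable R : realType.
Implicit Type gs : seq (crossing R).

Lemma traj_word_rot i gs : traj_word (rot i gs) = rot i (traj_word gs).
Proof. by rewrite /traj_word map_rot. Qed.

Lemma traj_length_rot i gs : uniq gs -> traj_length (rot i gs) = traj_length gs.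
Proof.
move=> ug; rewrite /traj_length (perm_big gs) ?perm_rot //=.
by apply: eq_bigr => c _; rewrite next_rot.
Qed.

(** Lengths are multiplied by the same k in both directions, hence shortest and
    longest trajectories correspond.  On the way back it is enough to find the word
    up to rotation. *)
Lemma symbolic_orbit_transfer (x x' k : R) (F : seq nat -> seq nat) b w :
  0 < k ->
  (forall i u, exists j, F (rot i u) = rot j (F u)) ->
  (forall gs, closed_trajectory x gs -> exists2 gs', closed_trajectory x' gs' &
     traj_word gs' = F (traj_word gs) /\ traj_length gs' = k * traj_length gs) ->
  (forall gs', closed_trajectory x' gs' -> exists2 gs, closed_trajectory x gs &
     (exists i, traj_word gs' = rot i (F (traj_word gs))) /\
     traj_length gs' = k * traj_length gs) ->
  symbolic_orbit b x w -> symbolic_orbit b x' (F w).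
Proof.
move=> k0 Frot fwd bwd [[gs [cg minb] Ew] Hall].
split.
  have [gs' cg' [Ew' EL]] := fwd _ cg; exists gs'; last by rewrite Ew' Ew.
  split=> // gs2' /bwd[gs2 cg2 [_ EL2]]; have := minb _ cg2.
  by rewrite EL EL2; case: b {minb Hall}; rewrite ler_pM2l.
move=> gs' [cg' minb']; have [gs2 cg2 [[i Ei] EL]] := bwd _ cg'.
have [j Ej] : exists j, traj_word gs2 = rot j w.
  apply: Hall; split=> // gs3 /fwd[gs3' cg3' [_ EL3]]; have := minb' _ cg3'.
  by rewrite EL EL3; case: b {minb minb'}; rewrite ler_pM2l.
have [l El] := Frot j w; exists (rot_add (F w) l i).
by rewrite Ei Ej El rot_rot_add.
Qed.

Lemma shift_pos_label n p : (n <= 3)%N -> (p <= 4)%N ->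
  shift_symbol (4 - n) (pos_label p) = pos_label (new_pos n p).
Proof. by case: n => [|[|[|[|]]]] // _; case: p => [|[|[|[|[|]]]]]. Qed.

Lemma pos_label_inj : {in [pred p | (p <= 4)%N] &, injective pos_label}.
Proof. by move=> [|[|[|[|[|p]]]]] [|[|[|[|[|q]]]]]. Qed.

Lemma symbolic_orbit_new_dir n (A B x A' B' x' : R) b w :
  (n <= 3)%N -> 0 < A -> 0 < B -> new_dir (golden R) n A B = (A', B') -> 0 < A' -> 0 < B' ->
  x * (2 * golden R ^+ 2 * (A + B)) = B - A ->
  x' * (2 * golden R ^+ 2 * (A' + B')) = B' - A' ->
  symbolic_orbit b x w ->
  symbolic_orbit b x' [seq shift_symbol (4 - n)%N s | s <- reduction w].
Proof.
move=> n3 A0 B0 E A'0 B'0 xAB xAB'.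
set f := golden R; set g := golden_gaps f A B.
have ff : f ^+ 2 = f + 1 by exact: golden_sqr.
have gp : gaps_pos g by exact: golden_gaps_pos.
have Eg : new_gaps n g = golden_gaps f A' B' by rewrite new_golden_gaps // E.
have gp' : gaps_pos (new_gaps n g) by rewrite Eg; exact: golden_gaps_pos.
have AB0 : 0 < A + B by rewrite addr_gt0.
have AB'0 : 0 < A' + B' by rewrite addr_gt0.
pose C y := Num.sqrt (sin (pi / 5) ^+ 2 + y ^+ 2) : R.
have C0 y : 0 < C y.
  by rewrite sqrtr_gt0 ltr_pwDl ?sqr_ge0 // exprn_gt0 // s36_gt0.
pose k := C x' / C x * ((A' + B') / (A + B)).
have weightE s : ucycle (step g) s ->
    total_weight f (turn_states n g s) = (A' + B') / (A + B) * total_weight f s.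
  move=> us; have := total_weight_contract ff n3 gp gp' us; rewrite E /= => Ew.
  by rewrite mulrAC -Ew mulrC mulKf // lt0r_neq0.
have lenE c c' s : ucycle (step g) s ->
    traj_length (map (cross (golden_gaps f A' B') c') (turn_states n g s)) =
    k * traj_length (map (cross g c) s).
  move=> us; rewrite (traj_length_cross A0 B0 xAB) // (traj_length_cross A'0 B'0 xAB');
    last first.
    by rewrite -Eg; exact: ucycle_contract.
  rewrite weightE // /k -/(C x) -/(C x'); field.
  by rewrite !lt0r_neq0.
have wordE c c' s : ucycle (step g) s ->
    traj_word (map (cross (golden_gaps f A' B') c') (turn_states n g s)) =
    [seq shift_symbol (4 - n)%N t | t <- reduction (traj_word (map (cross g c) s))].
  move=> us; rewrite (traj_word_cross (A := A') (B := B')); last by rewrite -Eg;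
    exact: ucycle_contract.
  rewrite (traj_word_cross (A := A) (B := B)) // (reduction_turning gp pos_label_inj us).
  rewrite /turn_states -!map_comp; apply/eq_in_map => y /=; rewrite mem_filter => /andP[_ ys].
  have/andP[cs _] := us; have /and4P[/andP[y4 _] _ _ _] := next_cycle cs ys.
  by rewrite shift_pos_label.
apply: (@symbolic_orbit_transfer x x' k (fun u => [seq shift_symbol (4 - n)%N s | s <-
  reduction u])).
- by rewrite /k mulr_gt0 // divr_gt0.
- by move=> i u; have [j ->] := reduction_rot i u; exists j; rewrite map_rot.
- move=> gs /(closed_trajectory_coding A0 B0 xAB)[c [s [sn us ->]]].
  exists (map (cross (golden_gaps f A' B') c) (turn_states n g s)); last first.
    by rewrite (wordE c) ?(lenE c).
  apply/(closed_trajectory_coding A'0 B'0 xAB'); exists c, (turn_states n g s); split=> //;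
    last first.
    by rewrite -Eg; exact: ucycle_contract.
  move=> cn; have := total_weight_gt0 A0 B0 sn us.
  have := weightE _ us; rewrite cn /total_weight big_nil => /esym/eqP.
  by rewrite mulf_eq0 (gt_eqF (divr_gt0 AB'0 AB0)) /= => /eqP ->; rewrite ltxx.
- move=> gs' /(closed_trajectory_coding A'0 B'0 xAB')[c [t [/eqP tn ut ->]]].
  rewrite -Eg in ut; have [s us [i Et]] := ucycle_expand n3 gp gp' tn ut.
  exists (map (cross g c) s).
    apply/(closed_trajectory_coding A0 B0 xAB); exists c, s; split=> //.
    by move=> s0; move: tn; rewrite Et s0 /turn_states; case: (i).
  split.
    by exists i; rewrite Et map_rot traj_word_rot (wordE c).
  rewrite Et map_rot traj_length_rot ?(lenE c) //.
  have : closed_trajectory x' (map (cross (golden_gaps f A' B') c) t).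
    by apply/(closed_trajectory_coding A'0 B'0 xAB'); exists c, t; split=> //;
      [exact/eqP | rewrite -Eg].
  by case=> _ [d [_ /andP[_]]]; rewrite Et map_rot rot_uniq.
Qed.
End Transfer.

(** * The vertices of the ideal pentagons *)

Section Arcs.
Variable R : realType.
Local Notation f := (golden R).
Implicit Types (a b y z : R) (v : seq R) (I : Defs.arc R).

(** The action of [reflect_geodesic a b] away from the centre and infinity. *)
Definition inversion a b y : R := (a + b) / 2 + ((a - b) / 2) ^+ 2 / (y - (a + b) / 2).

Lemma outside_neq_center a b y : b < a -> (a <= y) || (y <= b) -> y - (a + b) / 2 != 0.
Proof. by move=> ba /orP[h|h]; [rewrite gt_eqF | rewrite lt_eqF]; lra. Qed.

Lemma inversion_between a b y : b < a -> (a <= y) || (y <= b) -> b <= inversion a b y <= a.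
Proof.
move=> ba out; set z := inversion a b y.
have E : (z - (a + b) / 2) * (y - (a + b) / 2) = ((a - b) / 2) ^+ 2.
  by rewrite /z /inversion addrAC subrr add0r mulfVK // outside_neq_center.
case/orP: out => h; apply/andP; split; nra.
Qed.

Lemma inversionP a b y z : y - (a + b) / 2 != 0 ->
  (z - (a + b) / 2) * (y - (a + b) / 2) = ((a - b) / 2) ^+ 2 -> inversion a b y = z.
Proof. by move=> h E; rewrite /inversion -E mulfK // addrC subrK. Qed.

Lemma inversion_inj a b y z : b < a -> (a <= y) || (y <= b) -> (a <= z) || (z <= b) ->
  inversion a b y = inversion a b z -> y = z.
Proof.
move=> ba oy oz /addrI; have r0 : ((a - b) / 2) ^+ 2 != 0 by rewrite expf_neq0 // gt_eqF; lra.
by move/(mulfI r0)/invr_inj/addIr.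
Qed.

Definition decreasing5 v := (size v == 5) && sorted >%O v.

Lemma decreasing5_sorted v : decreasing5 v -> sorted >=%O v.
Proof. by case/andP => _; apply: sub_sorted => y z; apply: ltW. Qed.

Lemma decreasing5_outside v m : decreasing5 v -> (m <= 3)%N ->
  nth 0 v m.+1 < nth 0 v m /\
  {in v, forall y, (nth 0 v m <= y) || (y <= nth 0 v m.+1)}.
Proof.
case/andP=> /eqP sv; case: v sv => [|v0 [|v1 [|v2 [|v3 [|v4 [|]]]]]] //= _.
case/and5P=> h0 h1 h2 h3 _; case: m => [|[|[|[|]]]] //= _; split=> // y;
 rewrite !inE => /or4P[/eqP->|/eqP->|/eqP->|/orP[/eqP->|/eqP->]]; apply/orP; (try by left;
   lra); by right; lra.
Qed.

Lemma vertices_across_sub_arc I v m : vertices_across I = v -> decreasing5 v -> (m <= 3)%N ->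
  vertices_across (sub_arc I m) =
  sort (fun y z : R => z <= y) (map (inversion (nth 0 v m) (nth 0 v m.+1)) v).
Proof.
move=> Ev dv m3; have [ba out] := decreasing5_outside dv m3.
rewrite /sub_arc Ev /vertices_across /=; congr sort.
move: (nth 0 v m) (nth 0 v m.+1) ba out => a b ba; elim: v {Ev dv} => [//|y s IH] out /=.
have -> : (y == (a + b) / 2) = false.
  by rewrite -subr_eq0; apply/negbTE; apply: outside_neq_center => //; apply: out;
    exact: mem_head.
by rewrite /= IH // => z zs; apply: out; rewrite inE zs orbT.
Qed.

Lemma decreasing5_sub_arc v m : decreasing5 v -> (m <= 3)%N ->
  let w := sort (fun y z : R => z <= y) (map (inversion (nth 0 v m) (nth 0 v m.+1)) v) in
  decreasing5 w /\ {in w, forall z, nth 0 v m.+1 <= z <= nth 0 v m}.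
Proof.
move=> dv m3 w; have [ba out] := decreasing5_outside dv m3.
have uv : uniq v by case/andP: dv => _ sv; rewrite -rev_uniq lt_sorted_uniq // rev_sorted.
split; last first.
  by move=> z; rewrite mem_sort => /mapP[y yv ->]; apply: inversion_between => //; exact: out.
rewrite /decreasing5 size_sort size_map; case/andP: (dv) => -> _ /=.
have uw : uniq w.
  rewrite sort_uniq map_inj_in_uniq // => y z /out oy /out oz; exact: inversion_inj.
have sw : sorted (fun y z : R => z <= y) w by apply: sort_sorted => y z; exact: le_total.
by rewrite -[w]revK rev_sorted lt_sorted_uniq_le rev_uniq uw rev_sorted.
Qed.

Section Moebius.
Variables (p q r t lo hi : R).
Hypotheses (det_lt0 : p * t - q * r < 0) (den_gt0 : forall y, lo <= y <= hi -> 0 < r * y + t).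

Definition moebius y : R := (p * y + q) / (r * y + t).
Local Notation T := moebius.

Lemma moebius_decr y z : lo <= y <= hi -> lo <= z <= hi -> y < z -> T z < T y.
Proof.
move=> /den_gt0 dy /den_gt0 dz yz; rewrite /moebius ltr_pdivrMr // mulrAC ltr_pdivlMr //.
rewrite -subr_gt0.
have -> : (p * y + q) * (r * z + t) - (p * z + q) * (r * y + t) =
  (p * t - q * r) * (y - z) by ring.
by rewrite nmulr_rgt0 // subr_lt0.
Qed.

(** Moebius maps preserve harmonic quadruples, and [inversion a b y] is the harmonic
    conjugate of [y] with respect to [a] and [b]. *)
Lemma moebius_inversion a b y : b < a -> lo <= b -> a <= hi -> lo <= y <= hi ->
  (a <= y) || (y <= b) ->
  T (inversion a b y) = inversion (T b) (T a) (T y).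
Proof.
move=> ba lob ahi yi out; have nc := outside_neq_center ba out.
have ib : lo <= b <= hi by lra.
have ia : lo <= a <= hi by lra.
have iz : lo <= inversion a b y <= hi by have := inversion_between ba out; lra.
have Tba := moebius_decr ib ia ba.
have Tout : (T b <= T y) || (T y <= T a).
  case/orP: out; rewrite le_eqVlt => /orP[/eqP <-|h].
  - by rewrite lexx orbT.
  - by rewrite orbC ltW // moebius_decr.
  - by rewrite lexx.
  - by rewrite ltW // moebius_decr.
apply/esym/inversionP; first exact: outside_neq_center.
have E : (inversion a b y - (a + b) / 2) * (y - (a + b) / 2) = ((a - b) / 2) ^+ 2.
  by rewrite /inversion addrAC subrr add0r mulfVK.
move: (inversion a b y) iz E => z /den_gt0/lt0r_neq0 dz E.
move: (den_gt0 ia) (den_gt0 ib) (den_gt0 yi) => /lt0r_neq0 da /lt0r_neq0 db /lt0r_neq0 dy.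
rewrite /moebius; apply/eqP; rewrite -subr_eq0; apply/eqP.
(* harmonic conjugacy as an equation that is symmetric in y and z *)
have {}E : z * y - (a + b) / 2 * (z + y) + a * b = 0 by move: E; lra.
transitivity ((z * y - (a + b) / 2 * (z + y) + a * b) * (p * t - q * r) ^+ 2 /
   ((r * a + t) * (r * b + t) * (r * z + t) * (r * y + t))).
  by field; rewrite da db dz dy.
by rewrite E !mul0r.
Qed.

(** The map T is decreasing, so the order of the vertices is reversed. *)
Definition mirrored I I' := exists v,
  [/\ vertices_across I = v, vertices_across I' = rev (map T v), decreasing5 v &
      {in v, forall y, lo <= y <= hi}].

Lemma decreasing5_mirror v : decreasing5 v -> {in v, forall y, lo <= y <= hi} ->
  decreasing5 (rev (map T v)).
Proof.
rewrite /decreasing5 size_rev size_map rev_sorted => /andP[-> sv] hv /=.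
rewrite sorted_map; apply: (@sub_in_sorted _ (mem v) >%O) sv; last exact/allP.
by move=> y z /hv yi /hv zi yz; apply: moebius_decr.
Qed.

Lemma rev_sort_moebius u : {in u, forall y, lo <= y <= hi} ->
  sort (fun y z : R => z <= y) (rev (map T u)) =
  rev (map T (sort (fun y z : R => z <= y) u)).
Proof.
move=> hu; have ge_total : total (fun y z : R => z <= y) by move=> y z; exact: le_total.
apply: (@sorted_eq _ (fun y z : R => z <= y)).
- by move=> y z w zy yw; exact: le_trans yw zy.
- by move=> y z; rewrite andbC => /le_anti.
- exact: sort_sorted.
- rewrite rev_sorted sorted_map.
  apply: (@sub_in_sorted _ (mem u) (fun y z : R => z <= y)).
  + move=> y z /hu yi /hu zi /=; rewrite le_eqVlt => /orP[/eqP-> //|zy].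
    by rewrite ltW // moebius_decr.
  + by apply/allP => y; rewrite mem_sort.
  + exact: sort_sorted.
- by rewrite perm_sort perm_rev perm_sym perm_rev perm_map // perm_sort.
Qed.

(** Under T the vertices [v_m] and [v_(m + 1)] become the entries [4 - m] and
    [3 - m] of the reversed list, and T commutes with the reflections. *)
Lemma mirrored_sub_arc m I I' : (m <= 3)%N -> mirrored I I' ->
  mirrored (sub_arc I m) (sub_arc I' (3 - m)).
Proof.
move=> m3 [v [Ev Ev' dv hv]]; have [ba out] := decreasing5_outside dv m3.
have sv : size v = 5 by case/andP: dv => /eqP.
have [am bm] : nth 0 v m \in v /\ nth 0 v m.+1 \in v.
  by split; apply: mem_nth; rewrite sv; move: m3; case: (m) => [|[|[|[|]]]].
have := vertices_across_sub_arc Ev' (decreasing5_mirror dv hv) (leq_subr m 3).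
have := vertices_across_sub_arc Ev dv m3; have [] := decreasing5_sub_arc dv m3.
have -> : nth 0 (rev (map T v)) (3 - m) = T (nth 0 v m.+1).
  by move: sv m3; case: (v) => [|v0 [|v1 [|v2 [|v3 [|v4 [|]]]]]] //; case: (m) => [|[|[|[|]]]].
have -> : nth 0 (rev (map T v)) (3 - m).+1 = T (nth 0 v m).
  by move: sv m3; case: (v) => [|v0 [|v1 [|v2 [|v3 [|v4 [|]]]]]] //; case: (m) => [|[|[|[|]]]].
move: (nth 0 v m) (nth 0 v m.+1) ba out am bm => a b ba out am bm.
have /andP[_ ahi] := hv _ am; have /andP[lob _] := hv _ bm.
set w := sort _ _ => dw hw Ew Ew'; exists w; split=> //.
  rewrite Ew' /w map_rev -rev_sort_moebius; last first.
    move=> z /mapP[y yv ->]; have := inversion_between ba (out y yv); lra.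
  congr (sort _ (rev _)); rewrite -!map_comp; apply/eq_in_map => y yv /=.
  by rewrite moebius_inversion ?out ?hv.
by move=> z /hw; lra.
Qed.

Lemma mirrored_foldl ns I I' : all (fun n => (n <= 3)%N) ns -> mirrored I I' ->
  mirrored (foldl (@sub_arc R) I ns) (foldl (@sub_arc R) I' [seq (3 - n)%N | n <- ns]).
Proof.
by elim: ns I I' => [|n ns IH] I I' //= /andP[n3 nsall] II'; apply: IH => //;
  apply: mirrored_sub_arc.
Qed.

Lemma mirrored_top I I' m : mirrored I I' -> (0 < m <= 3)%N ->
  arc_top (sub_arc I' (4 - m)) = T (arc_top (sub_arc I m)) /\
  lo < arc_top (sub_arc I m) < hi.
Proof.
case=> v [Ev Ev' /andP[/eqP sv dv] hv]; rewrite /sub_arc /= Ev Ev'.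
case: v sv dv hv {Ev Ev'} => [|v0 [|v1 [|v2 [|v3 [|v4 [|]]]]]] //= _ dv hv.
have := hv v0 (mem_head _ _); have : lo <= v4 <= hi by apply: hv; rewrite !inE eqxx !orbT.
case/and5P: dv => h0 h1 h2 h3 _ b4 b0.
by case: m => [|[|[|[|]]]] //= _; rewrite /rev /=; split=> //; lra.
Qed.
End Moebius.

Let ff : f ^+ 2 = f + 1 := golden_sqr R.
Let f_bounds : 8 / 5 < f < 13 / 8.
Proof. have := golden_gt1 R; move: ff; rewrite expr2; nra. Qed.

Definition arc0_vertices : seq R :=
  [:: (2 - f) / 2; (5 * f - 8) / 2; 0; - ((5 * f - 8) / 2); - ((2 - f) / 2)].

Lemma arc0_vertices_decr : decreasing5 arc0_vertices.
Proof. rewrite /decreasing5 /=; have := f_bounds; lra. Qed.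

Lemma vertices_across_arc0 : vertices_across (arc0 R) = arc0_vertices.
Proof.
have /andP[f1 f2] := f_bounds; have fn0 : f != 0 by rewrite gt_eqF; lra.
rewrite /vertices_across [pmap _ _](_ : _ = arc0_vertices).
  apply: sorted_sort; last exact: decreasing5_sorted arc0_vertices_decr.
  by move=> y z w zy yw; exact: le_trans yw zy.
rewrite /arc0 /= /arc0_vertices.
have -> : (1 - f / 2 + (f / 2 - 1)) / 2 = 0 by lra.
have e1 : (1 - f / 2 == 0) = false by rewrite gt_eqF //; lra.
have e2 : (f / 2 == 0) = false by rewrite gt_eqF //; lra.
have e3 : (- (f / 2) == 0) = false by rewrite lt_eqF //; lra.
have e4 : (f / 2 - 1 == 0) = false by rewrite lt_eqF //; lra.
have e5 : f - 2 != 0 by rewrite lt_eqF //; lra.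
rewrite e1 e2 e3 e4 /= !subr0 !add0r; congr [:: _; _; _; _; _].
- by field: ff; lra.
- by field: ff.
- by field: ff.
- by field: ff; lra.
Qed.

(** The action of [new_dir n] on the abscissa x for A = 1 - 2 f^2 x, B = 1 + 2 f^2 x,
    as [new_dir_moebius] shows. *)
Definition moebius_coef (n : nat) : R * R * R * R :=
  match n with
  | 0 => (- (8 * f + 6), f, 20 * f + 12, 2)
  | 1 => (- (14 * f + 8), f - 1, 8 * f + 4, 2 * f)
  | 2 => (- (14 * f + 8), 1 - f, - (8 * f + 4), 2 * f)
  | _ => (- (8 * f + 6), - f, - (20 * f + 12), 2)
  end.

Lemma new_dir_moebius n y :
  let: (p, q, r, t) := moebius_coef n in
  let d := new_dir f n (1 - 2 * f ^+ 2 * y) (1 + 2 * f ^+ 2 * y) in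
  d.2 - d.1 = p * y + q /\ 2 * f ^+ 2 * (d.1 + d.2) = r * y + t.
Proof. by case: n => [|[|[|n]]] /=; split; ring: ff. Qed.

Lemma new_dir_gt0 n y : (n <= 3)%N ->
  nth 0 arc0_vertices n.+1 < y < nth 0 arc0_vertices n ->
  let d := new_dir f n (1 - 2 * f ^+ 2 * y) (1 + 2 * f ^+ 2 * y) in 0 < d.1 /\ 0 < d.2.
Proof.
have /andP[f1 f2] := f_bounds.
case: n => [|[|[|[|]]]] //= _ /andP[y1 y2].
- split; [rewrite [ltRHS](_ : _ = (6 * f + 4) * (y - (5 * f - 8) / 2)) | rewrite [ltRHS](_ : _
  = (2 * f + 2) * ((2 - f) / 2 - y))];
  first [by apply: mulr_gt0; lra | by field: ff].
- split; [rewrite [ltRHS](_ : _ = (8 * f + 4) * y) | rewrite [ltRHS](_ : _ = (6 * f + 4) * ((5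
  * f - 8) / 2 - y))];
  first [by apply: mulr_gt0; lra | by field: ff].
- split; [rewrite [ltRHS](_ : _ = (6 * f + 4) * (y + (5 * f - 8) / 2)) | rewrite [ltRHS](_ : _
  = (8 * f + 4) * (- y))];
  first [by apply: mulr_gt0; lra | by field: ff].
- split; [rewrite [ltRHS](_ : _ = (2 * f + 2) * (y + (2 - f) / 2)) | rewrite [ltRHS](_ : _ = (6
  * f + 4) * (- y - (5 * f - 8) / 2))];
  first [by apply: mulr_gt0; lra | by field: ff].
Qed.

Lemma sector_dir_gt0 n y : (n <= 3)%N ->
  nth 0 arc0_vertices n.+1 < y < nth 0 arc0_vertices n ->
  0 < 1 - 2 * f ^+ 2 * y /\ 0 < 1 + 2 * f ^+ 2 * y.
Proof.
have /andP[f1 f2] := f_bounds.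
rewrite (_ : 1 - _ = (2 * f + 2) * ((2 - f) / 2 - y)); last by field: ff.
rewrite (_ : 1 + _ = (2 * f + 2) * ((2 - f) / 2 + y)); last by field: ff.
by case: n => [|[|[|[|]]]] //= _ /andP[y1 y2]; split; apply: mulr_gt0; lra.
Qed.

(** The vertices of the pentagon beyond the n-th sub-arc, in the order of the entries
    of [arc0_vertices] whose reflections they are. *)
Definition arc0_inversions (n : nat) : seq R :=
  nth [::] [::
    [:: 1 - f / 2; -4 + 5 / 2 * f; 5 / 2 - 3 / 2 * f; - (2 / 5) + 3 / 10 * f; 9 - 11 / 2 * f];
    [:: - (7 / 11) + 9 / 22 * f; -4 + 5 / 2 * f; 0; - (4 / 3) + 5 / 6 * f; 9 / 5 - 11 / 10 * f];
    [:: - (9 / 5) + 11 / 10 * f; 4 / 3 - 5 / 6 * f; 0; 4 - 5 / 2 * f; 7 / 11 - 9 / 22 * f];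
    [:: -9 + 11 / 2 * f; 2 / 5 - 3 / 10 * f; - (5 / 2) + 3 / 2 * f; 4 - 5 / 2 * f;
      -1 + f / 2]] n.

Lemma map_inversion_arc0 n : (n <= 3)%N ->
  map (inversion (nth 0 arc0_vertices n) (nth 0 arc0_vertices n.+1)) arc0_vertices =
  arc0_inversions n.
Proof.
move=> n3; have [ba out] := decreasing5_outside arc0_vertices_decr n3.
have P z y : y \in arc0_vertices ->
    (z - (nth 0 arc0_vertices n + nth 0 arc0_vertices n.+1) / 2) *
    (y - (nth 0 arc0_vertices n + nth 0 arc0_vertices n.+1) / 2) =
    ((nth 0 arc0_vertices n - nth 0 arc0_vertices n.+1) / 2) ^+ 2 ->
    inversion (nth 0 arc0_vertices n) (nth 0 arc0_vertices n.+1) y = z.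
  by move=> /out yo; apply: inversionP; apply: outside_neq_center.
rewrite /arc0_inversions; case: n n3 P {ba out} => [|[|[|[|]]]] // _ P;
  congr [:: _; _; _; _; _]; apply: P; rewrite ?inE ?eqxx ?orbT //=; by field: ff.
Qed.

Lemma arc0_den_gt0 n y : (n <= 3)%N ->
  nth 0 arc0_vertices n.+1 <= y <= nth 0 arc0_vertices n ->
  let: (p, q, r, t) := moebius_coef n in 0 < r * y + t.
Proof.
have /andP[f1 f2] := f_bounds.
by case: n => [|[|[|[|]]]] //= _ /andP[y1 y2]; nra.
Qed.

(** The pentagon beyond the n-th sub-arc is sent to the pentagon beyond the whole
    sector, and the reflected cyclic order of its vertices to the original one. *)
Lemma map_moebius_arc0 n : (n <= 3)%N ->
  let: (p, q, r, t) := moebius_coef n in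
  map (moebius p q r t) (arc0_inversions n) = rotr n.+1 arc0_vertices.
Proof.
move=> n3; have [ba out] := decreasing5_outside arc0_vertices_decr n3.
have den z : z \in arc0_inversions n ->
    let: (p, q, r, t) := moebius_coef n in r * z + t != 0.
  rewrite -map_inversion_arc0 // => /mapP[y /out yo ->].
  have := arc0_den_gt0 n3 (inversion_between ba yo).
  by case: (moebius_coef n) => [[[p q] r] t] /lt0r_neq0.
rewrite /moebius; case: n n3 den {ba out} => [|[|[|[|]]]] // _ den; rewrite /rotr /rot /=;
  congr [:: _; _; _; _; _]; apply: (canLR (mulfK (den _ _))); rewrite ?inE ?eqxx ?orbT //;
    by field: ff.
Qed.

Lemma moebius_det_lt0 n : let: (p, q, r, t) := moebius_coef n in p * t - q * r < 0.
Proof. by have /andP[f1 f2] := f_bounds; case: n => [|[|[|n]]] /=; nra. Qed.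

Lemma mirrored_arc0 n : (n <= 3)%N ->
  let: (p, q, r, t) := moebius_coef n in
  mirrored p q r t (nth 0 arc0_vertices n.+1) (nth 0 arc0_vertices n)
    (arc_of R [:: n]) (arc0 R).
Proof.
move=> n3; have := map_moebius_arc0 n3; have := @arc0_den_gt0 n ^~ n3.
have := moebius_det_lt0 n; case: (moebius_coef n) => [[[p q] r] t] det den ET.
have dv := arc0_vertices_decr.
have Ev := vertices_across_sub_arc vertices_across_arc0 dv n3.
have [dw hw] := decreasing5_sub_arc dv n3.
move: Ev dw hw; rewrite map_inversion_arc0 //; set w := sort _ _ => Ew dw hw.
exists w; split=> //; rewrite vertices_across_arc0 -(rev_sort_moebius det den) => [|z zs];
  last first.
  by apply: hw; rewrite mem_sort.
rewrite ET.
have ge_tot : total (fun y z : R => z <= y) by move=> y z; exact: le_total.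
apply: (@sorted_eq _ (fun y z : R => z <= y)).
- by move=> y z u zy yu; exact: le_trans yu zy.
- by move=> y z; rewrite andbC => /le_anti.
- exact: decreasing5_sorted.
- exact: sort_sorted.
- by rewrite perm_sym perm_sort perm_rev perm_rotr.
Qed.

Lemma alpha_moebius n1 nk ns : (n1 <= 3)%N -> all (fun n => (n <= 3)%N) ns ->
  (0 < nk <= 3)%N ->
  let: (p, q, r, t) := moebius_coef n1 in
  alpha R (rcons [seq (3 - n)%N | n <- ns] (4 - nk)%N) =
    moebius p q r t (alpha R (n1 :: rcons ns nk)) /\
  nth 0 arc0_vertices n1.+1 < alpha R (n1 :: rcons ns nk) < nth 0 arc0_vertices n1.
Proof.
move=> n3 nsall nk3; have := mirrored_arc0 n3; have := @arc0_den_gt0 n1 ^~ n3.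
have := moebius_det_lt0 n1; case: (moebius_coef n1) => [[[p q] r] t] det den M.
have := mirrored_top (mirrored_foldl det den nsall M) nk3.
by rewrite /alpha /arc_of /= !foldl_rcons.
Qed.
End Arcs.

Theorem theorem6 (R : realType) (b : strip_kind) (n1 nk : nat) (ns : seq nat)
    (w : seq nat)
    (Hn1 : (n1 <= 3)%N) (Hns : all (fun n => (n <= 3)%N) ns)
    (Hnk : (nk <= 3)%N) (Hnk0 : nk <> 0%N)
    (Hw : symbolic_orbit b (alpha R (n1 :: rcons ns nk)) w) :
  symbolic_orbit b
    (alpha R (rcons [seq (3 - n)%N | n <- ns] (4 - nk)%N))
    [seq shift_symbol (4 - n1)%N s | s <- reduction w].
Proof.
have nk3 : (0 < nk <= 3)%N by rewrite Hnk andbT lt0n; apply/eqP.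
have := @alpha_moebius R _ _ _ Hn1 Hns nk3; have := @arc0_den_gt0 R n1 ^~ Hn1.
have := @new_dir_moebius R n1; case: (moebius_coef R n1) => [[[p q] r] t] dirE den [Ex' xin].
move: Ex' xin Hw; set x := alpha R (n1 :: _); set x' := alpha R (rcons _ _) => Ex' xin Hw.
have [/= num_x den_x] := dirE x.
have [d1_gt0 d2_gt0] := new_dir_gt0 Hn1 xin.
case/andP: (xin) => x_lo x_hi; have := den x; rewrite (ltW x_lo) (ltW x_hi) => /(_ isT) den_gt0.
have [A0 B0] := sector_dir_gt0 Hn1 xin.
apply: (@symbolic_orbit_new_dir R n1 _ _ x _ _ x') A0 B0 (surjective_pairing _) d1_gt0 d2_gt0 _
  _ Hw => //.
  by ring.
by rewrite Ex' den_x num_x /moebius mulfVK // lt0r_neq0.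
Qed.
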